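(* There exists a universal constant $K>0$ such that the following holds. Let $N\ge 20$ be an integer, let $\mathbf C=[c_{ij}]\in\mathbb R^{N\times N}$ be doubly centered, and let $\mathbf A=[a_{ij}]\in\mathbb R^{N\times N}$ have all entries in $[-1,1]$. Let $\pi$ be uniformly distributed over $\mathcal S_N$ and put $$Q_{\mathsf{QF}}:=\sum_{i,j\in[N]}c_{ij}\,a_{\pi(i)\pi(j)}.$$ Then for every $t>0$: (i) $$\mathrm P\big(Q_{\mathsf{QF}}-\mathrm E[Q_{\mathsf{QF}}]\ge t\big)\le \exp\Big\{-\frac{Kt^2}{\|\mathbf C\|_{\mathsf F}^2+\big(\|\mathbf C\|_{\mathsf{op}}+\max_{\sigma\in\mathcal S_N}\|\mathbf C\circ\mathbf A^{\sigma}\|_{\mathsf{op}}\big)t}\Big\}.$$ (ii) If moreover $\mathbf A$ is positive semidefinite, then $$\mathrm P\big(Q_{\mathsf{QF}}-\mathrm E[Q_{\mathsf{QF}}]\ge t\big)\le \exp\Big(-\frac{Kt^2}{\|\mathbf C\|_{\mathsf F}^2+\|\mathbf C\|_{\mathsf{op}}\,t}\Big).$$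
   Context: $[N]=\{1,\dots,N\}$ and $\mathcal S_N$ is the group of permutations of $[N]$. The matrices $\mathbf A,\mathbf C$ are fixed (deterministic). A matrix $\mathbf C=[c_{ij}]$ is doubly centered if $\sum_{i=1}^N c_{ik}=\sum_{j=1}^N c_{kj}=0$ for all $k\in[N]$. $\|\cdot\|_{\mathsf{op}}$ is the spectral (operator) norm and $\|\cdot\|_{\mathsf F}$ the Frobenius norm. For $\sigma\in\mathcal S_N$, $\mathbf A^\sigma$ denotes the matrix with $(i,j)$ entry $a_{\sigma(i)\sigma(j)}$, and $\circ$ is the Hadamard (entrywise) product. ''Universal constant'' means that $K$ does not depend on $N,\mathbf A,\mathbf C,t$. *)

(* Defs.v *)
From HB Require Import structures.
From mathcomp Require Import all_boot all_order all_algebra all_fingroup.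
From mathcomp Require Import all_classical all_reals all_analysis.

Set Implicit Arguments.
Unset Strict Implicit.
Unset Printing Implicit Defensive.

Import Order.TTheory GRing.Theory Num.Theory.
Import numFieldNormedType.Exports.

Local Open Scope classical_set_scope.
Local Open Scope ring_scope.

Definition doubly_centered (R : realType) (N : nat) (C : 'M[R]_N) : Prop :=
  forall k : 'I_N, \sum_(i < N) C i k = 0 /\ \sum_(j < N) C k j = 0.

Definition frobenius_norm (R : realType) (m n : nat) (A : 'M[R]_(m, n)) : R :=
  Num.sqrt (\sum_(i < m) \sum_(j < n) A i j ^+ 2).

(* On column vectors [frobenius_norm] is the Euclidean norm; the library's
   [`|x|] on matrices is the max-entry norm. *)
Definition opnorm (R : realType) (m n : nat) (A : 'M[R]_(m, n)) : R :=
  sup [set frobenius_norm (A *m x) | x in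
        [set x : 'cV[R]_n | frobenius_norm x <= 1]].

Definition hadamard (R : realType) (m n : nat) (A B : 'M[R]_(m, n)) :
    'M[R]_(m, n) :=
  map2_mx *%R A B.

Definition conj_perm (R : realType) (N : nat) (A : 'M[R]_N) (s : 'S_N) :
    'M[R]_N :=
  \matrix_(i, j) A (s i) (s j).

(* The neutral element 0 is harmless: operator norms are nonnegative. *)
Definition max_opnorm_hadamard (R : realType) (N : nat) (C A : 'M[R]_N) : R :=
  \big[Num.max/0]_(s : 'S_N) opnorm (hadamard C (conj_perm A s)).

(* Symmetry is part of positive semidefiniteness for real matrices. *)
Definition possemidef (R : realType) (N : nat) (A : 'M[R]_N) : Prop :=
  A^T = A /\ forall x : 'cV[R]_N, 0 <= (x^T *m A *m x) 0 0.

(* ['S_N] carries no canonical sigma-algebra in the library; it is finite, so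
   measurability for the discrete one amounts to measurable fibres. *)
Definition uniform_perm (d : measure_display) (T : measurableType d)
    (R : realType) (P : probability T R) (N : nat) (pi : T -> 'S_N) : Prop :=
  forall s : 'S_N, measurable (pi @^-1` [set s]) /\
    P (pi @^-1` [set s]) = ((N`!%:R)^-1)%:E.

Definition QF (R : realType) (N : nat) (C A : 'M[R]_N) (s : 'S_N) : R :=
  \sum_(i < N) \sum_(j < N) C i j * A (s i) (s j).

(* Main.v *)
(* Split 4p positions into p "row" pairs and p "column" pairs. Composing pi with
   random swaps inside the pairs preserves its law and turns the doubly
   differenced statistic Y = sum_ij c_ij (a_ij - a_i'j - a_ij' + a_i'j') into a
   Rademacher chaos whose matrix is a signed sum of four submatrices of matrices
   C o A^sigma; this is where max_sigma ||C o A^sigma|| enters. Since C is doubly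
   centered, averaging Y over the choice of the pairs gives back Q, up to a
   factor of order 1, a linear statistic sum_i c_ii w(pi(i)) with bounded w, a
   remainder bounded by ||C||_F, and a constant. By convexity of exp it suffices
   to bound the three exponential moments separately; Chernoff's bound concludes.
   Part (ii) needs only the same bound, because for A positive semidefinite with
   diagonal at most 1 Schur's theorem gives ||C o A^sigma|| <= ||C||. *)

Require Import Defs.
From HB Require Import structures.
From mathcomp Require Import all_boot all_order all_algebra all_fingroup.
From mathcomp Require Import all_classical all_reals all_analysis.
From mathcomp Require Import ring lra.

Set Implicit Arguments.
Unset Strict Implicit.
Unset Printing Implicit Defensive.

Import Order.TTheory GRing.Theory Num.Theory.
Import numFieldNormedType.Exports.

Local Open Scope classical_set_scope.
Local Open Scope ring_scope.

(** * Averages over finite types *)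

Section Average.
Variable R : realType.
Implicit Types T U : finType.

Definition avg T (f : T -> R) : R := (\sum_x f x) / #|T|%:R.

Lemma eq_avg T (f g : T -> R) : f =1 g -> avg f = avg g.
Proof. by move=> fg; rewrite /avg (eq_bigr g). Qed.

Lemma avg_le T (f g : T -> R) : (forall x, f x <= g x) -> avg f <= avg g.
Proof.
by move=> fg; rewrite /avg ler_wpM2r ?invr_ge0 ?ler0n// ler_sum.
Qed.

Lemma avg_ge0 T (f : T -> R) : (forall x, 0 <= f x) -> 0 <= avg f.
Proof. by move=> f0; rewrite /avg divr_ge0// sumr_ge0. Qed.

Lemma avg_cst T (a : R) : (0 < #|T|)%N -> avg (fun _ : T => a) = a.
Proof.
move=> T0; rewrite /avg sumr_const -[a *+ _]mulr_natr mulfK//.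
by rewrite pnatr_eq0 -lt0n.
Qed.

Lemma avgD T (f g : T -> R) : avg (fun x => f x + g x) = avg f + avg g.
Proof. by rewrite /avg big_split/= mulrDl. Qed.

Lemma avgZ T a (f : T -> R) : avg (fun x => a * f x) = a * avg f.
Proof. by rewrite /avg -mulr_sumr mulrA. Qed.

Lemma avgN T (f : T -> R) : avg (fun x => - f x) = - avg f.
Proof. by rewrite /avg sumrN mulNr. Qed.

Lemma avgB T (f g : T -> R) : avg (fun x => f x - g x) = avg f - avg g.
Proof. by rewrite avgD avgN. Qed.

Lemma avg_sum T (I : Type) (r : seq I) (P : pred I) (f : I -> T -> R) :
  avg (fun x => \sum_(i <- r | P i) f i x) = \sum_(i <- r | P i) avg (f i).
Proof. by rewrite /avg exchange_big/= mulr_suml. Qed.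

Lemma avg_exchange T U (f : T -> U -> R) :
  avg (fun x => avg (f x)) = avg (fun y => avg (f^~ y)).
Proof.
rewrite /avg -!mulr_suml exchange_big/= -!mulrA; congr (_ * _).
by rewrite mulrC.
Qed.

Lemma avg_bij T (h : T -> T) (f : T -> R) :
  bijective h -> avg f = avg (fun x => f (h x)).
Proof. by move=> hb; rewrite /avg (reindex h)//; apply: onW_bij. Qed.

(** Jensen's inequality: the tangent line of exp at the mean [m] lies below exp, and averaging the
    tangent gives exp of [m]. *)
Lemma expR_avg T (f : T -> R) :
  (0 < #|T|)%N -> expR (avg f) <= avg (fun x => expR (f x)).
Proof.
move=> T0; set m := avg f.
suff H : avg (fun x => expR m * (1 + (f x - m))) <= avg (fun x => expR (f x)).
  apply: le_trans H; rewrite avgZ avgD avgB !avg_cst// -/m; lra.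
apply: avg_le => x.
have -> : expR (f x) = expR m * expR (f x - m) by rewrite -expRD addrC subrK.
by rewrite ler_wpM2l ?expR_ge0// expR_ge1Dx.
Qed.

Lemma sqr_avg T (f : T -> R) :
  (0 < #|T|)%N -> avg f ^+ 2 <= avg (fun x => f x ^+ 2).
Proof.
move=> T0; set m := avg f.
have : 0 <= avg (fun x => (f x - m) ^+ 2) by apply: avg_ge0 => x; exact: sqr_ge0.
rewrite (eq_avg (g := fun x => f x ^+ 2 - (2 * m * f x - m ^+ 2))).
  rewrite avgB avgB avgZ avg_cst// -/m; lra.
by move=> x; ring.
Qed.

End Average.

(** * Elementary real inequalities *)

Section Real.
Variable R : realType.

Lemma cauchy_schwarz_sum (I : finType) (a b : I -> R) :
  (\sum_i a i * b i) ^+ 2 <= (\sum_i a i ^+ 2) * (\sum_i b i ^+ 2).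
Proof.
have : 0 <= \sum_i \sum_j (a i * b j - a j * b i) ^+ 2.
  by apply: sumr_ge0 => i _; apply: sumr_ge0 => j _; exact: sqr_ge0.
have -> : \sum_i \sum_j (a i * b j - a j * b i) ^+ 2 =
  \sum_i \sum_j (a i ^+ 2 * b j ^+ 2) + \sum_i \sum_j (b i ^+ 2 * a j ^+ 2)
  - 2 * (\sum_i \sum_j (a i * b i) * (a j * b j)).
  rewrite mulr_sumr -big_split -sumrB/=; apply: eq_bigr => i _.
  rewrite mulr_sumr -big_split -sumrB/=; apply: eq_bigr => j _.
  by ring.
rewrite -!big_distrlr/= -expr2; nra.
Qed.

(** For |x| >= 1 both exponentials are at most exp |x| <= exp (2 x^2). Otherwise put y = x / 2: from
    1 + z <= exp z one gets e^y + e^-y <= 2 / (1 - y^2), and squaring this gives cosh x <= 1 + 2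
    x^2. *)
Lemma cosh_le (x : R) : (expR x + expR (- x)) / 2 <= expR (2 * x ^+ 2).
Proof.
have [x1|x1] := leP 1 `|x|.
  have h (y : R) : `|y| = `|x| -> expR y <= expR (2 * x ^+ 2).
    move=> yx; rewrite ler_expR (le_trans (ler_norm y))// yx -real_normK ?num_real//.
    nra.
  have := h x erefl; have := h (- x) (normrN _); lra.
set y := x / 2.
have y2 : y ^+ 2 < 4^-1.
  have : x ^+ 2 < 1 by rewrite -real_normK ?num_real// expr_lt1.
  rewrite /y; lra.
have h (z : R) : z ^+ 2 < 4^-1 -> expR z * (1 - z) <= 1.
  move=> z2; have := expR_ge1Dx (- z) => hz.
  have e : expR z * expR (- z) = 1 by rewrite -expRD subrr expR0.
  have := expR_gt0 z; nra.
have hp : expR y * (1 - y) <= 1 by exact: h.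
have hm : expR (- y) * (1 + y) <= 1.
  by have := h (- y); rewrite opprK sqrrN; apply.
have e1 : expR y * expR (- y) = 1 by rewrite -expRD subrr expR0.
have ex : expR x = expR y ^+ 2 by rewrite expr2 -expRD /y; congr expR; lra.
have emx : expR (- x) = expR (- y) ^+ 2.
  by rewrite expr2 -expRD /y; congr expR; lra.
have p0 := expR_gt0 y; have m0 := expR_gt0 (- y).
apply: le_trans (expR_ge1Dx _).
have -> : 2 * x ^+ 2 = 8 * y ^+ 2 by rewrite /y; field.
rewrite ex emx; move: hp hm e1 p0 m0 y2.
set u := expR y; set v := expR (- y) => hp hm e1 p0 m0 y2.
have yp : 0 < 1 + y by nra.
have ym : 0 < 1 - y by nra.
have s : (u + v) * (1 - y ^+ 2) <= 2.
  have su : u * (1 - y) * (1 + y) <= 1 + y by rewrite ger_pMl.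
  have sv : v * (1 + y) * (1 - y) <= 1 - y by rewrite ger_pMl.
  have -> : (u + v) * (1 - y ^+ 2) =
    u * (1 - y) * (1 + y) + v * (1 + y) * (1 - y) by ring.
  lra.
have sp : 0 < u + v by lra.
have t0 : 0 <= y ^+ 2 by exact: sqr_ge0.
(* Since u v = 1, u^2 + v^2 = (u + v)^2 - 2. *)
suff : (u + v) ^+ 2 <= 4 + 16 * y ^+ 2 by nra.
have s2 : (u + v) ^+ 2 * (1 - y ^+ 2) ^+ 2 <= 4.
  rewrite -exprMn; have : 0 <= (u + v) * (1 - y ^+ 2) by nra.
  nra.
set t := y ^+ 2 in s2 t0 y2 *.
have k : 1 <= (1 + 4 * t) * (1 - t) ^+ 2 by nra.
have : 0 < (1 - t) ^+ 2 by rewrite exprn_gt0//; lra.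
move: s2 k; set w := (1 - t) ^+ 2; set z := (u + v) ^+ 2 => s2 k w0.
rewrite -(ler_pM2r w0); nra.
Qed.

End Real.

(** * Rademacher sums and decoupled chaos *)

Section Rademacher.
Variable R : realType.

Definition sgb (b : bool) : R := (-1) ^+ b.

Lemma sgb_addb b c : sgb (b (+) c) = sgb b * sgb c.
Proof. by rewrite /sgb signr_addb. Qed.

Lemma sgb_sqr b : sgb b ^+ 2 = 1.
Proof. by rewrite /sgb sqrr_sign. Qed.

Lemma sgb_neg b : sgb (~~ b) = - sgb b.
Proof. by rewrite /sgb signrN. Qed.

Lemma card_signs_gt0 (I : finType) : (0 < #|{: {ffun I -> bool}}|)%N.
Proof. by rewrite card_ffun card_bool expn_gt0. Qed.

(** The signs are independent, so the average of the product of exponentials is a product of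
    hyperbolic cosines, each bounded by [cosh_le]. *)
Lemma avg_rademacher (I : finType) (w : I -> R) :
  avg (fun e : {ffun I -> bool} => expR (\sum_i sgb (e i) * w i)) <=
  expR (2 * \sum_i w i ^+ 2).
Proof.
rewrite /avg card_ffun card_bool natrX -[#|I|]/#|I| mulr_sumr expR_sum.
have -> : \sum_(e : {ffun I -> bool}) expR (\sum_i sgb (e i) * w i) =
    \prod_i \sum_(b : bool) expR (sgb b * w i).
  by rewrite bigA_distr_bigA; apply: eq_bigr => e _; rewrite expR_sum.
rewrite -prodr_const -prodf_div; apply: ler_prod => i _.
rewrite big_bool/= /sgb expr0 expr1 mul1r mulN1r addrC divr_ge0 ?addr_ge0 ?expR_ge0//=.
exact: cosh_le.
Qed.

Definition flip (I : finType) (d e : {ffun I -> bool}) : {ffun I -> bool} :=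
  [ffun i => e i (+) d i].

Lemma flip_bij (I : finType) (d : {ffun I -> bool}) : bijective (flip d).
Proof.
by exists (flip d) => e; apply/ffunP => i; rewrite !ffunE addbK.
Qed.

Lemma avg_sgb (I : finType) (i : I) :
  avg (fun e : {ffun I -> bool} => sgb (e i)) = 0.
Proof.
have := avg_bij (fun e : {ffun I -> bool} => sgb (e i)) (flip_bij [ffun => true]).
under [X in _ = X]eq_avg do rewrite !ffunE addbT sgb_neg.
rewrite avgN; lra.
Qed.

Lemma avg_sgb2 (I : finType) (i j : I) : i != j ->
  avg (fun e : {ffun I -> bool} => sgb (e i) * sgb (e j)) = 0.
Proof.
move=> ij.
have := avg_bij (fun e : {ffun I -> bool} => sgb (e i) * sgb (e j))
  (flip_bij [ffun k => k == i]).
under [X in _ = X]eq_avg do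
  rewrite !ffunE eqxx eq_sym (negbTE ij) addbT addbF sgb_neg mulNr.
rewrite avgN; lra.
Qed.

(* A random cut [e] separates [i] from [j] in this order with probability 1/4:
   this is what decouples a quadratic form. *)
Lemma avg_cut (I : finType) (i j : I) : i != j ->
  avg (fun e : {ffun I -> bool} => (e i)%:R * (~~ e j)%:R) = 4^-1 :> R.
Proof.
move=> ij.
rewrite (eq_avg (g := fun e : {ffun I -> bool} => 4^-1 + 4^-1 * sgb (e j)
   - 4^-1 * sgb (e i) - 4^-1 * (sgb (e i) * sgb (e j)))).
  rewrite !avgB avgD !avgZ avg_cst ?card_signs_gt0// !avg_sgb avg_sgb2//; lra.
by move=> e; rewrite /sgb; case: (e i); case: (e j);
  rewrite /= ?expr0 ?expr1; lra.
Qed.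

End Rademacher.

Section Chaos.
Variables (R : realType) (I J : finType) (q : I -> J -> R) (L : R).
Local Notation sgb := (sgb R).

Definition sqnorm_app (v : J -> R) : R := \sum_i (\sum_j q i j * v j) ^+ 2.

Hypothesis qL : forall v, sqnorm_app v <= L ^+ 2 * \sum_j v j ^+ 2.

(** A matrix and its transpose have the same norm: S = |q^T u|^2 equals the inner product of u and q
    q^T u, so Cauchy-Schwarz and [qL] give S^2 <= |u|^2 L^2 S, and one divides by S. *)
Lemma sqnorm_tr_le (u : I -> R) :
  \sum_j (\sum_i q i j * u i) ^+ 2 <= L ^+ 2 * \sum_i u i ^+ 2.
Proof.
set S := \sum_j _; pose v j := \sum_i q i j * u i.
have S0 : 0 <= S by apply: sumr_ge0 => j _; exact: sqr_ge0.
have u0 : 0 <= \sum_i u i ^+ 2 by apply: sumr_ge0 => j _; exact: sqr_ge0.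
have : S ^+ 2 <= (\sum_i u i ^+ 2) * (L ^+ 2 * S).
  have eS : S = \sum_i u i * \sum_j q i j * v j.
    under [RHS]eq_bigr do rewrite mulr_sumr.
    rewrite exchange_big/=; apply: eq_bigr => j _.
    by rewrite expr2 -/(v j) mulr_suml; apply: eq_bigr => i _; ring.
  rewrite {1}eS; apply: (le_trans (cauchy_schwarz_sum _ _)).
  by apply: ler_wpM2l => //; exact: (qL v).
have : 0 <= L ^+ 2 by exact: sqr_ge0.
move: S0 u0; set l := L ^+ 2; set U := \sum_i _ => S0 U0 l0 h.
have [->|Sn] := eqVneq S 0; first by rewrite mulr_ge0.
have Sp : 0 < S by rewrite lt_def Sn.
rewrite -(ler_pM2r Sp); lra.
Qed.

(** What remains of the chaos once the signs indexed by [I] have been averaged out with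
    [avg_rademacher]. *)
Definition phi (s : R) : R :=
  avg (fun e : {ffun J -> bool} => expR (s * sqnorm_app (fun j => sgb (e j)))).

Local Notation F := (\sum_i \sum_j q i j ^+ 2).

Lemma sqnorm_app_half (v w : J -> R) :
  sqnorm_app (fun j => (v j + w j) / 2) <= (sqnorm_app v + sqnorm_app w) / 2.
Proof.
rewrite /sqnorm_app -big_split/= mulr_suml; apply: ler_sum => i _.
have -> : \sum_j q i j * ((v j + w j) / 2) =
    ((\sum_j q i j * v j) + (\sum_j q i j * w j)) / 2.
  by rewrite -big_split/= mulr_suml; apply: eq_bigr => j _; ring.
set a := \sum_j _; set b := \sum_j _; have := sqr_ge0 (a - b); nra.
Qed.

Lemma avg_cut_if (j k : J) :
  avg (fun c : {ffun J -> bool} => (c j)%:R * (~~ c k)%:R) =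
  4^-1 * (k != j)%:R :> R.
Proof.
have [->|kj] := eqVneq; last by rewrite avg_cut 1?eq_sym// mulr1.
rewrite mulr0 /avg big1 ?mul0r// => c _.
by case: (c j); rewrite ?mulr0 ?mul0r.
Qed.

(** Signs square to 1, so the diagonal terms add up to the squared Frobenius norm of q. Each
    off-diagonal term survives a random cut [c] with probability 1/4, whence the factor 4. *)
Lemma sqnorm_app_decoupled (e : {ffun J -> bool}) :
  sqnorm_app (fun j => sgb (e j)) =
  avg (fun c : {ffun J -> bool} => F + 4 * \sum_j sgb (e j) * ((c j)%:R *
    \sum_i q i j * \sum_k q i k * ((~~ c k)%:R * sgb (e k)))).
Proof.
pose G j k := \sum_i q i j * q i k * (sgb (e j) * sgb (e k)).
rewrite (eq_avg (g := fun c : {ffun J -> bool} =>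
    F + \sum_j \sum_k (4 * G j k) * ((c j)%:R * (~~ c k)%:R))); last first.
  move=> c; congr (_ + _); rewrite mulr_sumr; apply: eq_bigr => j _.
  rewrite !mulr_sumr.
  under eq_bigr do rewrite !mulr_sumr.
  rewrite exchange_big/=; apply: eq_bigr => k _.
  by rewrite /G mulr_sumr mulr_suml; apply: eq_bigr => i _; ring.
rewrite avgD avg_cst ?card_signs_gt0// avg_sum/=.
under [X in _ = _ + X]eq_bigr do rewrite avg_sum.
have -> : sqnorm_app (fun j => sgb (e j)) = \sum_j \sum_k G j k.
  rewrite /sqnorm_app.
  under eq_bigr do rewrite expr2 big_distrlr/=.
  rewrite exchange_big/=; apply: eq_bigr => j _.
  rewrite exchange_big/=; apply: eq_bigr => k _.
  by apply: eq_bigr => i _; ring.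
have -> : F = \sum_j G j j.
  rewrite exchange_big/=; apply: eq_bigr => j _; apply: eq_bigr => i _.
  by rewrite -!expr2 sgb_sqr mulr1.
rewrite -big_split/=; apply: eq_bigr => j _.
rewrite (bigD1 j)//=; congr (_ + _).
rewrite [RHS](bigD1 j)//= avgZ avg_cut_if eqxx !mulr0 add0r.
by apply: eq_bigr => k kj; rewrite avgZ avg_cut_if kj mulr1; field.
Qed.

(** For a fixed cut the exponent is linear in the signs inside [c], with coefficients that depend
    only on the signs outside. Averaging the former by [avg_rademacher] leaves the squared norm of q
    applied to a truncated sign vector, with constant 2 (4 s)^2 L^2; convexity then removes the
    truncation. *)
Lemma phi_decoupled (s : R) (c : {ffun J -> bool}) :
  avg (fun e : {ffun J -> bool} => expR (\sum_j sgb (e j) * ((4 * s) *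
    ((c j)%:R * \sum_i q i j * \sum_k q i k * ((~~ c k)%:R * sgb (e k)))))) <=
  phi (32 * s ^+ 2 * L ^+ 2).
Proof.
set H := fun e => expR _.
(* Resample only the signs inside the cut; this preserves the law of [e] and leaves [w e]
   unchanged. *)
pose d (x e : {ffun J -> bool}) := flip [ffun j => x j && c j] e.
have -> : avg H = avg (fun e => avg (fun x => H (d x e))).
  rewrite avg_exchange -[LHS](avg_cst _ (card_signs_gt0 J)).
  by apply: eq_avg => x; apply: avg_bij; exact: flip_bij.
pose w (e : {ffun J -> bool}) k := (~~ c k)%:R * sgb (e k).
apply: (@le_trans _ _ (avg (fun e => expR (32 * s ^+ 2 * L ^+ 2 * sqnorm_app (w e))))).
  apply: avg_le => e.
  rewrite (eq_avg (g := fun x : {ffun J -> bool} => expR (\sum_j sgb (x j) *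
    (sgb (e j) * ((4 * s) * ((c j)%:R * \sum_i q i j * \sum_k q i k * w e k)))))).
    apply: (le_trans (avg_rademacher _)); rewrite ler_expR.
    rewrite -mulrA.
    have h := sqnorm_tr_le (fun i => \sum_k q i k * w e k).
    have s2 := sqr_ge0 s.
    suff : \sum_j (sgb (e j) * (4 * s * ((c j)%:R *
        \sum_i q i j * \sum_k q i k * w e k))) ^+ 2 <=
        16 * s ^+ 2 * (L ^+ 2 * sqnorm_app (w e)) by lra.
    apply: (@le_trans _ _ (16 * s ^+ 2 *
        \sum_j (\sum_i q i j * \sum_k q i k * w e k) ^+ 2)); last first.
      by rewrite ler_wpM2l// mulr_ge0.
    rewrite mulr_sumr; apply: ler_sum => j _.
    rewrite !exprMn sgb_sqr; have := sqr_ge0 (\sum_i q i j * \sum_k q i k * w e k).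
    by case: (c j); rewrite /=; nra.
  move=> x; congr expR; apply: eq_bigr => j _.
  rewrite !ffunE sgb_addb.
  have -> : \sum_i q i j * \sum_k q i k * ((~~ c k)%:R * sgb (d x e k)) =
     \sum_i q i j * \sum_k q i k * w e k.
    apply: eq_bigr => i _; congr (_ * _); apply: eq_bigr => k _; congr (_ * _).
    by rewrite /w !ffunE; case: (c k); rewrite ?mul0r// andbF addbF.
  by case: (c j); rewrite ?andbT /=; ring.
set r := 32 * s ^+ 2 * L ^+ 2.
have r0 : 0 <= r by rewrite mulr_ge0 ?sqr_ge0// mulr_ge0 ?sqr_ge0.
(* The truncated vector [w e] is the midpoint of the sign vectors of [e] and [flip c e], which have
   the same law. *)
apply: (@le_trans _ _ (avg (fun e : {ffun J -> bool} =>
    2^-1 * expR (r * sqnorm_app (fun j => sgb (e j))) +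
    2^-1 * expR (r * sqnorm_app (fun j => sgb (flip c e j)))))); last first.
  rewrite avgD !avgZ.
  rewrite -(avg_bij (fun e : {ffun J -> bool} =>
    expR (r * sqnorm_app (fun j => sgb (e j)))) (flip_bij c)) -/(phi r); lra.
apply: avg_le => e; set A := fun j => _; set B := fun j => sgb (flip c e j).
have -> : w e = fun j => (A j + B j) / 2.
  apply/funext => j; rewrite /A /B /w ffunE sgb_addb /sgb.
  by case: (c j); rewrite /= ?expr0 ?expr1; lra.
have hAB := sqnorm_app_half A B.
set a := sqnorm_app A in hAB *; set b := sqnorm_app B in hAB *.
have h2 := ler_wpM2l r0 hAB.
have mid : expR ((r * a + r * b) / 2) <= 2^-1 * expR (r * a) + 2^-1 * expR (r * b).
  have := expR_avg (fun x : bool => if x then r * a else r * b).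
  by rewrite /avg card_bool !big_bool/= => /(_ isT); lra.
by apply: le_trans mid; rewrite ler_expR; lra.
Qed.

(* Decoupling gives [phi s <= exp (s F) * phi (s / 2)] in the stated range, and
   [phi (s / 2) ^ 2 <= phi s]; [phi s] is thus bounded by itself. *)
Lemma phi_le (s : R) : 0 <= s -> 64 * s * L ^+ 2 <= 1 -> phi s <= expR (2 * (s * F)).
Proof.
move=> s0 sL.
have step : phi s <= expR (s * F) * phi (s / 2).
  apply: (@le_trans _ _ (avg (fun e : {ffun J -> bool} =>
    avg (fun c : {ffun J -> bool} => expR (s * F) *
    expR (\sum_j sgb (e j) * ((4 * s) *
    ((c j)%:R * \sum_i q i j * \sum_k q i k * ((~~ c k)%:R * sgb (e k))))))))).
    apply: avg_le => e; rewrite sqnorm_app_decoupled -avgZ.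
    apply: (le_trans (expR_avg _ (card_signs_gt0 J))).
    apply: avg_le => c; rewrite -expRD ler_expR mulrDr lerD2l mulrA !mulr_sumr.
    by rewrite le_eqVlt; apply/orP; left; apply/eqP; apply: eq_bigr => j _; ring.
  rewrite avg_exchange; apply: (@le_trans _ _ (avg (fun _ : {ffun J -> bool} =>
    expR (s * F) * phi (s / 2)))); last by rewrite avg_cst ?card_signs_gt0.
  apply: avg_le => c; rewrite avgZ ler_wpM2l ?expR_ge0//.
  apply: (le_trans (phi_decoupled s c)); apply: avg_le => e.
  (* The range of s is what makes 32 s^2 L^2 at most s / 2. *)
  rewrite ler_expR ler_wpM2r//; last by nra.
  by apply: sumr_ge0 => i _; exact: sqr_ge0.
have half : phi (s / 2) ^+ 2 <= phi s.
  apply: (le_trans (sqr_avg _ (card_signs_gt0 J))).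
  apply: avg_le => e; rewrite expr2 -expRD ler_expR; lra.
have p0 : 0 < phi (s / 2).
  apply: (@lt_le_trans _ _ (expR (avg (fun e : {ffun J -> bool} =>
    s / 2 * sqnorm_app (fun j => sgb (e j)))))); first exact: expR_gt0.
  exact: expR_avg (card_signs_gt0 J).
have -> : 2 * (s * F) = s * F + s * F by ring.
have e0 := expR_gt0 (s * F).
rewrite expRD; apply: (le_trans step); rewrite ler_pM2l//.
by rewrite -(ler_pM2r p0) -expr2 (le_trans half).
Qed.

(** Averaging over [d] first leaves [phi] at 2 mu^2, and [phi_le] applies there: its range condition
    becomes the hypothesis on [mu]. *)
Lemma rademacher_chaos (mu : R) : 128 * mu ^+ 2 * L ^+ 2 <= 1 ->
  avg (fun d : {ffun I -> bool} => avg (fun e : {ffun J -> bool} =>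
    expR (mu * \sum_i \sum_j sgb (d i) * sgb (e j) * q i j))) <=
  expR (4 * mu ^+ 2 * F).
Proof.
move=> muL; rewrite avg_exchange.
have m2 := sqr_ge0 mu.
have -> : 4 * mu ^+ 2 * F = 2 * ((2 * mu ^+ 2) * F) by ring.
apply: le_trans (phi_le _ _); [|lra|lra].
apply: avg_le => e.
rewrite (eq_avg (g := fun d : {ffun I -> bool} =>
    expR (\sum_i sgb (d i) * (mu * \sum_j q i j * sgb (e j))))).
  apply: (le_trans (avg_rademacher _)); rewrite ler_expR -mulrA ler_pM2l//.
  by rewrite mulr_sumr; apply: ler_sum => i _; rewrite exprMn.
move=> d; congr expR; rewrite mulr_sumr; apply: eq_bigr => i _.
by rewrite !mulr_sumr; apply: eq_bigr => j _; ring.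
Qed.

End Chaos.

(** * Operator norms *)

Section Opnorm.
Variable R : realType.

Lemma sqr_frobenius (m n : nat) (A : 'M[R]_(m, n)) :
  frobenius_norm A ^+ 2 = \sum_i \sum_j A i j ^+ 2.
Proof.
rewrite sqr_sqrtr//; apply: sumr_ge0 => i _; apply: sumr_ge0 => j _.
exact: sqr_ge0.
Qed.

Lemma frobenius_ge0 (m n : nat) (A : 'M[R]_(m, n)) : 0 <= frobenius_norm A.
Proof. exact: sqrtr_ge0. Qed.

Lemma sqr_frobenius_col (n : nat) (x : 'cV[R]_n) :
  frobenius_norm x ^+ 2 = \sum_i x i 0 ^+ 2.
Proof. by rewrite sqr_frobenius; apply: eq_bigr => i _; rewrite big_ord1. Qed.

Lemma frobeniusZ (n : nat) (a : R) (x : 'cV[R]_n) :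
  frobenius_norm (a *: x) = `|a| * frobenius_norm x.
Proof.
apply/eqP; rewrite -(@eqrXn2 _ 2)// ?mulr_ge0 ?frobenius_ge0//.
rewrite exprMn real_normK ?num_real// !sqr_frobenius_col mulr_sumr.
by apply/eqP; apply: eq_bigr => i _; rewrite mxE exprMn.
Qed.

Lemma frobenius_mulmx_le (m n : nat) (A : 'M[R]_(m, n)) (x : 'cV[R]_n) :
  frobenius_norm (A *m x) <= frobenius_norm A * frobenius_norm x.
Proof.
rewrite -(@ler_pXn2r _ 2)// ?nnegrE ?mulr_ge0 ?frobenius_ge0//.
rewrite exprMn sqr_frobenius sqr_frobenius_col !sqr_frobenius mulr_suml.
apply: ler_sum => i _; rewrite big_ord1 mxE; exact: cauchy_schwarz_sum.
Qed.

Lemma frobenius0 (n : nat) : frobenius_norm (0 : 'cV[R]_n) = 0.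
Proof. by rewrite -(scale0r 0) frobeniusZ normr0 mul0r. Qed.

Local Notation ball_image A :=
  [set frobenius_norm (A *m x) | x in [set x : 'cV[R]__ | frobenius_norm x <= 1]].

(** The supremum is meaningful only for a nonempty set that is bounded above; the Frobenius norm is
    a bound. *)
Lemma opnorm_has_sup (m n : nat) (A : 'M[R]_(m, n)) : has_sup (ball_image A).
Proof.
split.
  by exists (frobenius_norm (A *m (0 : 'cV_n))), 0 => //=; rewrite frobenius0.
exists (frobenius_norm A) => _ [x /= x1 <-].
rewrite (le_trans (frobenius_mulmx_le A x))//.
by rewrite -[leRHS]mulr1 ler_wpM2l// frobenius_ge0.
Qed.

Lemma opnorm_ge0 (m n : nat) (A : 'M[R]_(m, n)) : 0 <= opnorm A.
Proof.
apply: (@ub_le_sup _ (ball_image A)); first by case: (opnorm_has_sup A).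
by exists 0 => /=; rewrite ?mulmx0 frobenius0.
Qed.

Lemma opnorm_mulmx (m n : nat) (A : 'M[R]_(m, n)) (x : 'cV[R]_n) :
  frobenius_norm (A *m x) <= opnorm A * frobenius_norm x.
Proof.
have [x0|x0] := eqVneq (frobenius_norm x) 0.
  by rewrite (le_trans (frobenius_mulmx_le A x))// x0 !mulr0.
have xp : 0 < frobenius_norm x by rewrite lt_def x0 frobenius_ge0.
rewrite -ler_pdivrMr//.
apply: (@ub_le_sup _ (ball_image A)); first by case: (opnorm_has_sup A).
exists ((frobenius_norm x)^-1 *: x) => /=.
  by rewrite frobeniusZ ger0_norm ?invr_ge0 ?frobenius_ge0// mulVf.
by rewrite -scalemxAr frobeniusZ ger0_norm ?invr_ge0 ?frobenius_ge0// mulrC.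
Qed.

Lemma opnorm_le (m n : nat) (A : 'M[R]_(m, n)) (c : R) : 0 <= c ->
  (forall v : 'I_n -> R,
    \sum_i (\sum_j A i j * v j) ^+ 2 <= c ^+ 2 * \sum_j v j ^+ 2) ->
  opnorm A <= c.
Proof.
move=> c0 h; apply: ge_sup; first by case: (opnorm_has_sup A).
move=> _ [x /= x1 <-].
rewrite -(@ler_pXn2r _ 2)// ?nnegrE ?frobenius_ge0//.
rewrite sqr_frobenius_col; under eq_bigr do rewrite mxE.
apply: (le_trans (h _)); rewrite -sqr_frobenius_col.
by rewrite -[leRHS]mulr1 ler_wpM2l ?sqr_ge0// expr_le1// frobenius_ge0.
Qed.

Lemma sqr_opnorm_le (m n : nat) (A : 'M[R]_(m, n)) (v : 'I_n -> R) :
  \sum_i (\sum_j A i j * v j) ^+ 2 <= opnorm A ^+ 2 * \sum_j v j ^+ 2.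
Proof.
have := opnorm_mulmx A (\col_j v j).
rewrite -(@ler_pXn2r _ 2)// ?nnegrE ?mulr_ge0 ?frobenius_ge0 ?opnorm_ge0//.
rewrite exprMn !sqr_frobenius_col.
under eq_bigr do rewrite mxE.
under [X in _ * X]eq_bigr do rewrite mxE.
by under eq_bigr do under eq_bigr do rewrite mxE.
Qed.

Lemma sum_inj_le (I J : finType) (r : I -> J) (G : J -> R) :
  injective r -> (forall k, 0 <= G k) -> \sum_i G (r i) <= \sum_k G k.
Proof.
move=> rI G0; rewrite -(big_imset (h := r) (A := predT) G)/=; last by move=> ? ? _ _ /rI.
by rewrite [leRHS](bigID [in r @: predT])/= lerDl sumr_ge0.
Qed.

(** Passing to a submatrix does not increase the norm: extend [v] by zero to all columns, apply the
    whole matrix, and drop the rows outside the image of [r]. *)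
Lemma sqr_opnorm_sub_le (I J : finType) (m n : nat) (A : 'M[R]_(m, n))
    (r : I -> 'I_m) (c : J -> 'I_n) (v : J -> R) : injective r -> injective c ->
  \sum_i (\sum_j A (r i) (c j) * v j) ^+ 2 <= opnorm A ^+ 2 * \sum_j v j ^+ 2.
Proof.
move=> rI cI; pose x k := \sum_(j | c j == k) v j.
have xc j : x (c j) = v j.
  by rewrite /x (big_pred1 j)// => j'; rewrite (inj_eq cI).
have Ax i : \sum_k A i k * x k = \sum_j A i (c j) * v j.
  rewrite [RHS](partition_big c predT)//=; apply: eq_bigr => k _.
  by rewrite mulr_sumr; apply: eq_bigr => j /eqP ->.
have x2 : \sum_k x k ^+ 2 = \sum_j v j ^+ 2.
  rewrite [RHS](partition_big c predT)//=; apply: eq_bigr => k _.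
  have [[j /eqP jk]|h] := altP (@existsP _ (fun j => c j == k)).
    rewrite -jk xc (big_pred1 j)// => j'; exact: (inj_eq cI).
  rewrite /x !big1 ?expr0n// => j jk.
    by case/negP: h; apply/existsP; exists j.
  by case/negP: h; apply/existsP; exists j.
rewrite -x2; apply: le_trans (sqr_opnorm_le A x).
under eq_bigr do rewrite -Ax.
by apply: (sum_inj_le (G := fun i => (\sum_k A i k * x k) ^+ 2)) => // k; exact: sqr_ge0.
Qed.

End Opnorm.

(** * Random swaps *)

Section Swap.
Variables (n : nat) (T : finType) (pos : T * bool -> 'I_n).
Hypothesis posI : injective pos.

(** Exchange the two members of every pair selected by [s] and fix all positions outside the pairs;
    this map is an involution, hence a permutation. *)
Lemma exists_swap (s : T -> bool) :
  exists tau : 'S_n, forall t b, tau (pos (t, b)) = pos (t, b (+) s t).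
Proof.
pose f x := if [pick u | pos u == x] is Some u then pos (u.1, u.2 (+) s u.1) else x.
have fpos u : f (pos u) = pos (u.1, u.2 (+) s u.1).
  by rewrite /f; case: pickP => [w /eqP/posI ->//|/(_ u)]; rewrite eqxx.
have fK : involutive f.
  move=> x; rewrite {2}/f; case: pickP => [u /eqP <-|h].
    by rewrite fpos /= addbK -surjective_pairing.
  by rewrite /f; case: pickP => // u; rewrite h.
by exists (perm (inv_inj fK)) => t b; rewrite permE fpos.
Qed.

End Swap.

Section SwapChaos.
Variables (R : realType) (n : nat) (I J : finType).
Variable pos : (I + J) * bool -> 'I_n.
Hypothesis posI : injective pos.
Local Notation sgb := (sgb R).

(** [I] indexes the row pairs and [J] the column pairs; the boolean chooses a member of the pair. *)
Let posl i b := pos (inl i, b).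
Let posr j b := pos (inr j, b).

Lemma avg_perm_mul (g : 'S_n -> R) (tau : 'S_n) :
  avg g = avg (fun s => g (tau * s)%g).
Proof.
by apply: avg_bij; exists (mulg tau^-1%g) => s; rewrite ?mulKg ?mulKVg.
Qed.

Lemma card_perm_gt0 : (0 < #|{: 'S_n}|)%N.
Proof. by rewrite card_Sn fact_gt0. Qed.

Lemma posl_inj b : injective (posl^~ b).
Proof. by move=> i i' /posI []. Qed.

Lemma posr_inj b : injective (posr^~ b).
Proof. by move=> i i' /posI []. Qed.

Section Linear.
Variables (d w : 'I_n -> R) (B : R).
Hypothesis wB : forall x, `|w x| <= B.

Definition swap_linear (s : 'S_n) : R :=
  \sum_i d (posl i false) * \sum_(b : bool) sgb b * w (s (posl i b)).

(** Swapping a pair negates its difference. Random swaps thus introduce Rademacher signs while the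
    uniform law of [s] is preserved. *)
Lemma swap_linear_mul (e : I -> bool) : exists tau : 'S_n, forall s : 'S_n,
  swap_linear (tau * s)%g = \sum_i sgb (e i) *
    (d (posl i false) * \sum_(b : bool) sgb b * w (s (posl i b))).
Proof.
have [tau h] := exists_swap posI (fun t => if t is inl i then e i else false).
exists tau => s; apply: eq_bigr => i _.
rewrite mulrCA; congr (_ * _); rewrite mulr_sumr.
rewrite [RHS](reindex_inj (inv_inj (fun b => addbK (e i) b)))/=.
apply: eq_bigr => b _; rewrite permM h sgb_addb.
transitivity (sgb (e i) ^+ 2 * (sgb b * w (s (pos (inl i, b (+) e i))))).
  by rewrite sgb_sqr mul1r.
by ring.
Qed.

Lemma avg_swap_linear : avg swap_linear = 0.
Proof.
have [tau h] := swap_linear_mul (fun=> true).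
have := avg_perm_mul swap_linear tau.
rewrite [X in _ = X](eq_avg (g := fun s => - swap_linear s)); first by rewrite avgN; lra.
by move=> s; rewrite h -sumrN; apply: eq_bigr => i _; rewrite /sgb expr1 mulN1r.
Qed.

(** For fixed [s] the sum is a Rademacher sum in the swaps, with coefficients at most 2 B |d|; hence
    the constant 8 = 2 * 2^2. *)
Lemma avg_expR_swap_linear (mu : R) :
  avg (fun s => expR (mu * swap_linear s)) <=
  expR (8 * mu ^+ 2 * B ^+ 2 * \sum_x d x ^+ 2).
Proof.
rewrite (_ : avg _ = avg (fun e : {ffun I -> bool} =>
    avg (fun s => expR (mu * swap_linear s)))); last first.
  by rewrite avg_cst// card_signs_gt0.
pose q (s : 'S_n) i := d (posl i false) * \sum_(b : bool) sgb b * w (s (posl i b)).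
rewrite (eq_avg (g := fun e : {ffun I -> bool} => avg (fun s =>
    expR (\sum_i sgb (e i) * (mu * q s i))))); last first.
  move=> e; have [tau h] := swap_linear_mul e.
  rewrite (avg_perm_mul _ tau); apply: eq_avg => s; rewrite h mulr_sumr.
  by congr expR; apply: eq_bigr => i _; rewrite mulrCA.
rewrite avg_exchange; apply: (@le_trans _ _ (avg (fun _ : 'S_n =>
    expR (8 * mu ^+ 2 * B ^+ 2 * \sum_x d x ^+ 2)))); last first.
  by rewrite avg_cst// card_perm_gt0.
apply: avg_le => s; apply: (le_trans (avg_rademacher _)); rewrite ler_expR.
have m2 := sqr_ge0 mu; have B2 := sqr_ge0 B.
apply: (@le_trans _ _ (2 * \sum_i 4 * mu ^+ 2 * B ^+ 2 * d (posl i false) ^+ 2)).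
  rewrite ler_pM2l//; apply: ler_sum => i _.
  rewrite /q !exprMn big_bool/= /sgb expr0 expr1 mulN1r mul1r.
  have h1 := wB (s (posl i true)); have h2 := wB (s (posl i false)).
  rewrite !ler_norml in h1 h2.
  have h3 : (- w (s (posl i true)) + w (s (posl i false))) ^+ 2 <= 4 * B ^+ 2 by nra.
  have := ler_wpM2l (mulr_ge0 m2 (sqr_ge0 (d (posl i false)))) h3; lra.
rewrite -mulr_sumr mulrA.
have -> : 2 * (4 * mu ^+ 2 * B ^+ 2) = 8 * mu ^+ 2 * B ^+ 2 by ring.
rewrite ler_wpM2l //; first by rewrite mulr_ge0// mulr_ge0.
by apply: (sum_inj_le (G := fun x => d x ^+ 2) (@posl_inj false)) => k; exact: sqr_ge0.
Qed.

End Linear.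

Section Bilinear.
Variables (C A : 'M[R]_n) (L : R).
Hypothesis A1 : forall i j, -1 <= A i j <= 1.
Hypothesis CL : forall s : 'S_n, opnorm (hadamard C (conj_perm A s)) <= L.

Definition swap_kernel (s : 'S_n) i j : R :=
  C (posl i false) (posr j false) *
  \sum_(b : bool) \sum_(b' : bool) sgb b * sgb b' * A (s (posl i b)) (s (posr j b')).

Definition swap_bilinear (s : 'S_n) : R := \sum_i \sum_j swap_kernel s i j.

(** A mixed second difference changes sign when its row pair is swapped, and again when its column
    pair is. *)
Lemma swap_kernel_mul (d : I -> bool) (e : J -> bool) :
  exists tau : 'S_n, forall (s : 'S_n) i j,
  swap_kernel (tau * s)%g i j = sgb (d i) * sgb (e j) * swap_kernel s i j.
Proof.
have [tau h] := exists_swap posI (fun t => match t with inl i => d i | inr j => e j end).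
exists tau => s i j.
rewrite /swap_kernel [RHS]mulrCA; congr (_ * _); rewrite mulr_sumr.
rewrite [RHS](reindex_inj (inv_inj (fun b => addbK (d i) b)))/=.
apply: eq_bigr => b _; rewrite mulr_sumr.
rewrite [RHS](reindex_inj (inv_inj (fun b => addbK (e j) b)))/=.
apply: eq_bigr => b' _; rewrite !permM !h !sgb_addb.
have hd := sgb_sqr R (d i); have he := sgb_sqr R (e j).
transitivity ((sgb (d i) ^+ 2) * (sgb (e j) ^+ 2) * (sgb b * sgb b' *
  A (s (pos (inl i, b (+) d i))) (s (pos (inr j, b' (+) e j))))).
  by rewrite hd he !mul1r.
by ring.
Qed.

Lemma avg_swap_bilinear : avg swap_bilinear = 0.
Proof.
have [tau h] := swap_kernel_mul (fun=> true) (fun=> false).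
have := avg_perm_mul swap_bilinear tau.
rewrite [X in _ = X](eq_avg (g := fun s => - swap_bilinear s)); first by rewrite avgN; lra.
move=> s; rewrite -sumrN; apply: eq_bigr => i _; rewrite -sumrN; apply: eq_bigr => j _.
by rewrite h /sgb expr1 expr0 mulr1 mulN1r.
Qed.

(** The kernel is a signed sum of four matrices [q b b'] of norm at most L, and the square of a sum
    of four terms is at most four times the sum of their squares. *)
Lemma swap_kernel_opnorm (s : 'S_n) (v : J -> R) :
  sqnorm_app (swap_kernel s) v <= (4 * L) ^+ 2 * \sum_j v j ^+ 2.
Proof.
have L0 : 0 <= L by exact: le_trans (opnorm_ge0 _) (CL 1%g).
pose q b b' i j : R :=
  C (posl i false) (posr j false) * A (s (posl i b)) (s (posr j b')).
have qL b b' : sqnorm_app (q b b') v <= L ^+ 2 * \sum_j v j ^+ 2.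
  (* Swapping all row pairs or none, and all column pairs or none, moves the [false] positions to
     the members b and b'; so [q b b'] is a submatrix of a Hadamard product covered by [CL]. *)
  have [tau h] := exists_swap posI (fun t => if t is inl i then b else b').
  have := CL (tau * s)%g; set D := hadamard _ _ => DL.
  have -> : q b b' = fun i j => D (posl i false) (posr j false).
    by apply/funext => i; apply/funext => j; rewrite /D !mxE !permM !h.
  apply: le_trans (sqr_opnorm_sub_le D v (@posl_inj false) (@posr_inj false)) _.
  rewrite ler_wpM2r ?sumr_ge0// => [j _|]; first exact: sqr_ge0.
  by rewrite ler_pXn2r// nnegrE opnorm_ge0.
apply: (@le_trans _ _ (4 * (sqnorm_app (q true true) v + sqnorm_app (q true false) v
   + sqnorm_app (q false true) v + sqnorm_app (q false false) v))); last first.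
  have := (qL true true, qL true false, qL false true, qL false false).
  case=> [[[]]]; rewrite exprMn; lra.
rewrite /sqnorm_app -!big_split/= mulr_sumr; apply: ler_sum => i _.
have -> : \sum_j swap_kernel s i j * v j = \sum_j q true true i j * v j -
    \sum_j q true false i j * v j - \sum_j q false true i j * v j +
    \sum_j q false false i j * v j.
  rewrite -!sumrB -big_split/=; apply: eq_bigr => j _.
  by rewrite /swap_kernel /q !big_bool /sgb/= expr0 expr1; ring.
set x := \sum_j _; set y := \sum_j _; set z := \sum_j _; set t := \sum_j _.
have := (sqr_ge0 (x + y), sqr_ge0 (x + z), sqr_ge0 (x - t), sqr_ge0 (y - z),
  sqr_ge0 (y + t), sqr_ge0 (z + t)); case=> [[[[[]]]]]; lra.
Qed.

Lemma swap_kernel_frobenius (s : 'S_n) :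
  \sum_i \sum_j swap_kernel s i j ^+ 2 <= 16 * frobenius_norm C ^+ 2.
Proof.
rewrite sqr_frobenius.
apply: (@le_trans _ _ (16 * \sum_i \sum_j C (posl i false) (posr j false) ^+ 2)).
  rewrite mulr_sumr; apply: ler_sum => i _; rewrite mulr_sumr; apply: ler_sum => j _.
  rewrite /swap_kernel exprMn mulrC ler_wpM2r ?sqr_ge0//.
  rewrite !big_bool /sgb/= expr0 expr1.
  have := (A1 (s (posl i true)) (s (posr j true)),
    A1 (s (posl i true)) (s (posr j false)), A1 (s (posl i false)) (s (posr j true)),
    A1 (s (posl i false)) (s (posr j false))).
  set x := A _ _; set y := A _ _; set z := A _ _; set t := A _ _.
  case=> [[[/andP[? ?] /andP[? ?]] /andP[? ?]] /andP[? ?]].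
  have : -4 <= x - y - z + t <= 4 by lra.
  have -> : -1 * -1 * x + -1 * 1 * y + (1 * -1 * z + 1 * 1 * t) = x - y - z + t by ring.
  by case/andP => ? ?; nra.
rewrite ler_pM2l//.
apply: (@le_trans _ _ (\sum_i \sum_j C (posl i false) j ^+ 2)).
  apply: ler_sum => i _.
  apply: (sum_inj_le (G := fun j => C (posl i false) j ^+ 2) (@posr_inj false)).
  by move=> k; exact: sqr_ge0.
apply: (sum_inj_le (G := fun i => \sum_j C i j ^+ 2) (@posl_inj false)).
by move=> k; apply: sumr_ge0 => j _; exact: sqr_ge0.
Qed.

(** For fixed [s] the random swaps produce a chaos with kernel norm at most 4 L and squared
    Frobenius norm at most 16 times that of C: 2048 = 128 * 4^2 and 64 = 4 * 16. *)
Lemma avg_expR_swap_bilinear (mu : R) : 2048 * mu ^+ 2 * L ^+ 2 <= 1 ->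
  avg (fun s => expR (mu * swap_bilinear s)) <=
  expR (64 * mu ^+ 2 * frobenius_norm C ^+ 2).
Proof.
move=> muL.
rewrite (_ : avg _ = avg (fun d : {ffun I -> bool} => avg (fun e : {ffun J -> bool} =>
    avg (fun s => expR (mu * swap_bilinear s))))); last first.
  by rewrite !avg_cst// card_signs_gt0.
pose G (s : 'S_n) (d : {ffun I -> bool}) (e : {ffun J -> bool}) := expR (mu *
    \sum_i \sum_j sgb (d i) * sgb (e j) * swap_kernel s i j).
rewrite (eq_avg (g := fun d => avg (fun s => avg (G s d)))); last first.
  move=> d; rewrite avg_exchange; apply: eq_avg => e.
  have [tau h] := swap_kernel_mul d e.
  rewrite (avg_perm_mul _ tau); apply: eq_avg => s; congr (expR (_ * _)).
  by apply: eq_bigr => i _; apply: eq_bigr => j _.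
rewrite avg_exchange; apply: (@le_trans _ _ (avg (fun _ : 'S_n =>
    expR (64 * mu ^+ 2 * frobenius_norm C ^+ 2)))); last first.
  by rewrite avg_cst// card_perm_gt0.
apply: avg_le => s.
apply: (le_trans (rademacher_chaos (swap_kernel_opnorm s) _)); first by lra.
rewrite ler_expR; have := swap_kernel_frobenius s; have := sqr_ge0 mu; nra.
Qed.

End Bilinear.

End SwapChaos.

(** * Averages over the symmetric group *)

Section PermAverages.
Variables (R : realType) (n : nat).
Local Notation nR := (n%:R : R).

(* Sampling without replacement: given [r] on [s], the value [r x] is uniform
   outside [r @: s]. *)
Lemma avg_vary (x : 'I_n) (s : seq 'I_n) (G : 'S_n -> 'I_n -> R) :
  uniq s ->
  (forall k, k \notin s -> forall r, G (tperm x k * r)%g = G r) ->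
  (nR - (size s)%:R) * avg (fun r => G r (r x)) =
  avg (fun r => \sum_u G r u - \sum_(y <- s) G r (r y)).
Proof.
move=> us hG.
rewrite [RHS](eq_avg (g := fun r => \sum_(k | k \notin s) G r (r k))); last first.
  move=> r; rewrite (reindex_inj (@perm_inj _ r))/= (bigID [in s])/=.
  rewrite -big_uniq//=.  by rewrite addrAC subrr add0r.
rewrite avg_sum (eq_bigr (fun=> avg (fun r => G r (r x)))); last first.
  move=> k ks; rewrite [RHS](avg_perm_mul _ (tperm x k)); apply: eq_avg => r.
  by rewrite hG// permM tpermL.
rewrite sumr_const -[RHS]mulr_natl; congr (_ * _).
have h : (size s + #|[pred k | k \notin s]|)%N = n.
  by rewrite -(card_uniqP us) (cardC (mem s)) card_ord.
have : (size s)%:R + #|[pred k | k \notin s]|%:R = nR by rewrite -natrD h.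
lra.
Qed.

Lemma avg_perm1 (x : 'I_n) (F : 'I_n -> R) :
  nR * avg (fun r : 'S_n => F (r x)) = \sum_u F u.
Proof.
have := @avg_vary x [::] (fun _ => F) isT; rewrite subr0 => ->//.
by rewrite (eq_avg (g := fun=> \sum_u F u)) ?avg_cst ?card_perm_gt0// => r; rewrite big_nil subr0.
Qed.

Lemma avg_vary1 (x y : 'I_n) (F : 'I_n -> 'I_n -> R) : uniq [:: x; y] ->
  (nR - 1) * avg (fun r : 'S_n => F (r x) (r y)) =
  avg (fun r : 'S_n => \sum_u F u (r y) - F (r y) (r y)).
Proof.
rewrite /= !inE => /andP[xy _].
rewrite (@avg_vary x [:: y] (fun r u => F u (r y)))//.
  by apply: eq_avg => r; rewrite big_seq1.
by move=> k; rewrite inE => ky r; rewrite permM tpermD.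
Qed.

Lemma avg_vary2 (x y z : 'I_n) (F : 'I_n -> 'I_n -> 'I_n -> R) :
  uniq [:: x; y; z] ->
  (nR - 2) * avg (fun r : 'S_n => F (r x) (r y) (r z)) =
  avg (fun r : 'S_n => \sum_u F u (r y) (r z)
    - (F (r y) (r y) (r z) + F (r z) (r y) (r z))).
Proof.
rewrite /= !inE !negb_or => /and3P[/andP[xy xz] yz _].
rewrite (@avg_vary x [:: y; z] (fun r u => F u (r y) (r z)))//=.
- by apply: eq_avg => r; rewrite big_cons big_seq1.
- by rewrite inE yz.
- move=> k; rewrite !inE negb_or => /andP[ky kz] r.
  by apply/funext => u; rewrite !permM !tpermD.
Qed.

Lemma avg_vary3 (x y z t : 'I_n) (F : 'I_n -> 'I_n -> 'I_n -> 'I_n -> R) :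
  uniq [:: x; y; z; t] ->
  (nR - 3) * avg (fun r : 'S_n => F (r x) (r y) (r z) (r t)) =
  avg (fun r : 'S_n => \sum_u F u (r y) (r z) (r t)
    - (F (r y) (r y) (r z) (r t) + (F (r z) (r y) (r z) (r t) +
       F (r t) (r y) (r z) (r t)))).
Proof.
rewrite /= !inE !negb_or => /and4P[/and3P[xy xz xt] /andP[yz yt] zt _].
rewrite (@avg_vary x [:: y; z; t] (fun r u => F u (r y) (r z) (r t)))//=.
- by apply: eq_avg => r; rewrite !big_cons big_nil addr0.
- by rewrite !inE negb_or yz yt zt.
- move=> k; rewrite !inE !negb_or => /and3P[ky kz kt] r.
  by apply/funext => u; rewrite !permM !tpermD.
Qed.

Definition offdiag (F : 'I_n -> 'I_n -> R) : R :=
  \sum_i \sum_j F i j - \sum_i F i i.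

Lemma avg_perm2 (x y : 'I_n) (F : 'I_n -> 'I_n -> R) : uniq [:: x; y] ->
  nR * (nR - 1) * avg (fun r : 'S_n => F (r x) (r y)) = offdiag F.
Proof.
move=> xy; rewrite -mulrA avg_vary1//.
rewrite (avg_perm1 y (fun v => \sum_u F u v - F v v)) sumrB.
by rewrite exchange_big.
Qed.

(** In the last three products some index of C is absent from B. Averaging over that index kills the
    full row or column sum of C and leaves only collisions with the other indices. Repeating this
    reduces everything to averages over two distinct indices, which [avg_perm2] evaluates. *)
Lemma avg_four (C B : 'M[R]_n) (x1 x2 x3 x4 : 'I_n) :
  doubly_centered C -> uniq [:: x1; x2; x3; x4] ->
  nR * (nR - 1) * (nR - 2) * (nR - 3) * avg (fun r : 'S_n =>
    C (r x1) (r x3) * (B (r x1) (r x3) - B (r x2) (r x3)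
      - B (r x1) (r x4) + B (r x2) (r x4))) =
  (nR ^+ 2 - 3 * nR + 1) * offdiag (fun i j => C i j * B i j)
  + offdiag (fun i j => C j i * B i j)
  + (nR - 1) * (offdiag (fun i j => C i i * B i j) + offdiag (fun i j => C j j * B i j))
  - (\sum_i C i i) * offdiag (fun i j => B i j).
Proof.
move=> hC; rewrite /= !inE !negb_or andbT => /and3P[/and3P[x12 x13 x14] /andP[x23 x24] x34].
have cc k : \sum_u C u k = 0 by have [] := hC k.
have cr k : \sum_u C k u = 0 by have [] := hC k.
pose c i j (r : 'S_n) := C (r i) (r j); pose b i j (r : 'S_n) := B (r i) (r j).
rewrite (eq_avg (g := fun r : 'S_n => c x1 x3 r * b x1 x3 r - c x1 x3 r * b x2 x3 r
  - c x1 x3 r * b x1 x4 r + c x1 x3 r * b x2 x4 r)); last first.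
  by move=> r; rewrite /c /b; ring.
rewrite avgD !avgB.
have e2 : (nR - 2) * avg (fun r : 'S_n => c x1 x3 r * b x2 x3 r) =
    - (avg (fun r : 'S_n => C (r x2) (r x3) * B (r x2) (r x3))
     + avg (fun r : 'S_n => C (r x3) (r x3) * B (r x2) (r x3))).
  rewrite (@avg_vary2 x1 x2 x3 (fun i j k => C i k * B j k)).
    rewrite -avgD -avgN; apply: eq_avg => r.
    by rewrite -mulr_suml cc mul0r add0r.
  by rewrite /= !inE !negb_or x12 x13 x23.
have e3 : (nR - 2) * avg (fun r : 'S_n => c x1 x3 r * b x1 x4 r) =
    - (avg (fun r : 'S_n => C (r x1) (r x1) * B (r x1) (r x4))
     + avg (fun r : 'S_n => C (r x1) (r x4) * B (r x1) (r x4))).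
  rewrite (@avg_vary2 x3 x1 x4 (fun i j k => C j i * B j k)).
    rewrite -avgD -avgN; apply: eq_avg => r.
    by rewrite -mulr_suml cr mul0r add0r.
  by rewrite /= !inE !negb_or (eq_sym x3) x13 x34 x14.
(* Here both indices of C are free. Removing x1 leaves three terms in which x3 is still free; [g1],
   [g2] and [g3] remove it, and the diagonal term in [g3] contributes the trace of C. *)
have e4 : (nR - 3) * avg (fun r : 'S_n => c x1 x3 r * b x2 x4 r) =
    - (avg (fun r : 'S_n => c x2 x3 r * b x2 x4 r) + (avg (fun r : 'S_n => c x3 x3 r * b x2 x4 r)
     + avg (fun r : 'S_n => c x4 x3 r * b x2 x4 r))).
  rewrite (@avg_vary3 x1 x2 x3 x4 (fun i j k l => C i k * B j l)).
    rewrite -!avgD -avgN; apply: eq_avg => r.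
    by rewrite -mulr_suml cc mul0r add0r.
  by rewrite /= !inE !negb_or x12 x13 x14 x23 x24 x34.
have g1 : (nR - 2) * avg (fun r : 'S_n => c x2 x3 r * b x2 x4 r) =
    - (avg (fun r : 'S_n => C (r x2) (r x2) * B (r x2) (r x4))
     + avg (fun r : 'S_n => C (r x2) (r x4) * B (r x2) (r x4))).
  rewrite (@avg_vary2 x3 x2 x4 (fun i j k => C j i * B j k)).
    rewrite -avgD -avgN; apply: eq_avg => r.
    by rewrite -mulr_suml cr mul0r add0r.
  by rewrite /= !inE !negb_or (eq_sym x3) x23 x34 x24.
have g2 : (nR - 2) * avg (fun r : 'S_n => c x4 x3 r * b x2 x4 r) =
    - (avg (fun r : 'S_n => C (r x4) (r x2) * B (r x2) (r x4))
     + avg (fun r : 'S_n => C (r x4) (r x4) * B (r x2) (r x4))).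
  rewrite (@avg_vary2 x3 x2 x4 (fun i j k => C k i * B j k)).
    rewrite -avgD -avgN; apply: eq_avg => r.
    by rewrite -mulr_suml cr mul0r add0r.
  by rewrite /= !inE !negb_or (eq_sym x3) x23 x34 x24.
have g3 : (nR - 2) * avg (fun r : 'S_n => c x3 x3 r * b x2 x4 r) =
    (\sum_i C i i) * avg (fun r : 'S_n => B (r x2) (r x4)) -
    (avg (fun r : 'S_n => C (r x2) (r x2) * B (r x2) (r x4))
     + avg (fun r : 'S_n => C (r x4) (r x4) * B (r x2) (r x4))).
  rewrite (@avg_vary2 x3 x2 x4 (fun i j k => C i i * B j k)).
    by rewrite -avgD -avgZ -avgB; apply: eq_avg => r; rewrite -mulr_suml.
  by rewrite /= !inE !negb_or (eq_sym x3) x23 x34 x24.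
set E1 := avg _; set E2 := avg _ in e2 *; set E3 := avg _ in e3 *.
set E4 := avg _ in e4 *; set G1 := avg _ in e4 g1.
set G2 := avg (fun r : 'S_n => c x4 x3 r * _) in e4 g2.
set G3 := avg (fun r : 'S_n => c x3 x3 r * _) in e4 g3.
have -> : nR * (nR - 1) * (nR - 2) * (nR - 3) * (E1 - E2 - E3 + E4) =
   nR * (nR - 1) * ((nR - 2) * (nR - 3) * E1 - (nR - 3) * ((nR - 2) * E2)
   - (nR - 3) * ((nR - 2) * E3) + (nR - 2) * ((nR - 3) * E4)) by ring.
rewrite e4 e2 e3.
have -> : (nR - 2) * - (G1 + (G3 + G2)) =
  - ((nR - 2) * G1 + (nR - 2) * G3 + (nR - 2) * G2) by ring.
rewrite g1 g2 g3.
have P y z (F : 'I_n -> 'I_n -> R) : y != z ->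
    nR * (nR - 1) * avg (fun r : 'S_n => F (r y) (r z)) = offdiag F.
  by move=> yz; apply: avg_perm2; rewrite /= inE yz.
have q1 := P _ _ (fun i j => C i j * B i j) x13.
have q2 := P _ _ (fun i j => C i j * B i j) x14.
have q3 := P _ _ (fun i j => C i j * B i j) x23.
have q4 := P _ _ (fun i j => C i j * B i j) x24.
have q5 := P _ _ (fun i j => C i i * B i j) x14.
have q6 := P _ _ (fun i j => C i i * B i j) x24.
have q7 := P _ _ (fun i j => C j j * B i j) x23.
have q8 := P _ _ (fun i j => C j j * B i j) x24.
have q9 := P _ _ (fun i j => C j i * B i j) x24.
have q0 := P _ _ (fun i j => B i j) x24.
rewrite -/E1 in q1; move: q1 q2 q3 q4 q5 q6 q7 q8 q9 q0.
set a2 := avg (fun r : 'S_n => C (r x1) (r x4) * B (r x1) (r x4)).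
set a3 := avg (fun r : 'S_n => C (r x2) (r x3) * B (r x2) (r x3)).
set a4 := avg (fun r : 'S_n => C (r x2) (r x4) * B (r x2) (r x4)).
set a5 := avg (fun r : 'S_n => C (r x1) (r x1) * B (r x1) (r x4)).
set a6 := avg (fun r : 'S_n => C (r x2) (r x2) * B (r x2) (r x4)).
set a7 := avg (fun r : 'S_n => C (r x3) (r x3) * B (r x2) (r x3)).
set a8 := avg (fun r : 'S_n => C (r x4) (r x4) * B (r x2) (r x4)).
set a9 := avg (fun r : 'S_n => C (r x4) (r x2) * B (r x2) (r x4)).
set a0 := avg (fun r : 'S_n => B (r x2) (r x4)).
set t := \sum_i _; set m := nR * (nR - 1) => q1 q2 q3 q4 q5 q6 q7 q8 q9 q0.
transitivity ((nR - 2) * (nR - 3) * (m * E1) + (nR - 3) * (m * a3 + m * a7)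
  + (nR - 3) * (m * a5 + m * a2) + (m * a6 + m * a4)
  - (t * (m * a0) - (m * a6 + m * a8)) + (m * a9 + m * a8)); first by ring.
by rewrite q1 q2 q3 q4 q5 q6 q7 q8 q9 q0; ring.
Qed.

End PermAverages.

(** * Exponential moments of the quadratic form *)

Section Mgf.
Variable R : realType.

(** Symmetrization: Jensen replaces the mean by an independent copy of X, exchanging the copies
    turns exp into cosh, and the differences are at most 2 B. *)
Lemma avg_expR_bounded (T : finType) (X : T -> R) (B lam : R) :
  (0 < #|T|)%N -> (forall x, `|X x| <= B) ->
  avg (fun x => expR (lam * (X x - avg X))) <= expR (8 * lam ^+ 2 * B ^+ 2).
Proof.
move=> T0 XB; pose g x y := expR (lam * (X x - X y)).
apply: (@le_trans _ _ (avg (fun x => avg (g x)))).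
  apply: avg_le => x; apply: le_trans (expR_avg _ T0); rewrite ler_expR.
  by rewrite avgZ avgB avg_cst.
have -> : avg (fun x => avg (g x)) = avg (fun x => avg (fun y => (g x y + g y x) / 2)).
  have e : avg (fun x => avg (g x)) = avg (fun x => avg (g^~ x)) by exact: avg_exchange.
  rewrite (eq_avg (f := fun x => avg (fun y => (g x y + g y x) / 2))
    (g := fun x => 2^-1 * avg (g x) + 2^-1 * avg (g^~ x))).
    rewrite avgD !avgZ -e; lra.
  by move=> x; rewrite -!avgZ -avgD; apply: eq_avg => y; ring.
apply: (@le_trans _ _ (avg (fun _ : T => avg (fun _ : T => expR (8 * lam ^+ 2 * B ^+ 2))))).
  apply: avg_le => x; apply: avg_le => y.
  rewrite /g; have -> : lam * (X y - X x) = - (lam * (X x - X y)) by ring.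
  apply: (le_trans (cosh_le _)); rewrite ler_expR exprMn.
  have := XB x; have := XB y; rewrite !ler_norml => /andP[? ?] /andP[? ?].
  have h : (X x - X y) ^+ 2 <= 4 * B ^+ 2 by nra.
  have := ler_wpM2l (sqr_ge0 lam) h; lra.
by rewrite !avg_cst.
Qed.

Lemma expR_add3 (x y z : R) :
  expR (x + y + z) <= (expR (3 * x) + expR (3 * y) + expR (3 * z)) / 3.
Proof.
have := expR_avg (fun i : 'I_3 => nth 0 [:: 3 * x; 3 * y; 3 * z] i).
rewrite /avg card_ord !big_ord_recl !big_ord0/= !addr0 !addrA => /(_ isT).
by have -> : (3 * x + 3 * y + 3 * z) / 3 = x + y + z by field.
Qed.

Lemma avg_expR_avg (T U : finType) (Y : T -> U -> R) (mu E : R) :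
  (0 < #|T|)%N -> (forall r, avg (fun s => expR (mu * Y r s)) <= E) ->
  avg (fun s => expR (mu * avg (Y^~ s))) <= E.
Proof.
move=> T0 h.
apply: (@le_trans _ _ (avg (fun s => avg (fun r => expR (mu * Y r s))))).
  by apply: avg_le => s; rewrite -avgZ; exact: expR_avg.
rewrite avg_exchange -[leRHS](avg_cst _ T0); exact: avg_le.
Qed.

Variables (n p : nat) (C A : 'M[R]_n) (L : R).
Variable pos : ('I_p + 'I_p) * bool -> 'I_n.
Hypothesis posI : injective pos.
Hypothesis n20 : (20 <= n)%N.
Hypothesis np : (n <= 8 * p)%N.
Hypothesis hC : doubly_centered C.
Hypothesis A1 : forall i j, -1 <= A i j <= 1.
Hypothesis CL : forall s : 'S_n, opnorm (hadamard C (conj_perm A s)) <= L.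

Local Notation nR := (n%:R : R).
Local Notation pR := (p%:R : R).
(** The coefficient of the quadratic form in [avg_four]. *)
Let m := nR ^+ 2 - 3 * nR + 1.
Let F := frobenius_norm C ^+ 2.

Let n20R : 20 <= nR.
Proof. by rewrite ler_nat. Qed.

Let npR : nR <= 8 * pR.
Proof. by rewrite -natrM ler_nat. Qed.

Let m_gt : nR < m.
Proof. rewrite /m; have := n20R; nra. Qed.

(** Averaging over [r] amounts to choosing the disjoint pairs at random. *)
Definition pos_mul (r : 'S_n) u := r (pos u).

Lemma pos_mul_inj r : injective (pos_mul r).
Proof. by move=> u v /perm_inj/posI. Qed.

Definition mean_bilinear (s : 'S_n) :=
  avg (fun r => swap_bilinear (pos_mul r) C A s).

Definition mean_linear (d w : 'I_n -> R) (s : 'S_n) :=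
  avg (fun r => swap_linear (pos_mul r) d w s).

Lemma mean_bilinearE (s : 'S_n) (B := conj_perm A s) :
  nR * (nR - 1) * (nR - 2) * (nR - 3) * mean_bilinear s =
  pR ^+ 2 * (m * offdiag (fun i j => C i j * B i j)
  + offdiag (fun i j => C j i * B i j)
  + (nR - 1) * (offdiag (fun i j => C i i * B i j) + offdiag (fun i j => C j j * B i j))
  - (\sum_i C i i) * offdiag (fun i j => B i j)).
Proof.
rewrite /mean_bilinear /swap_bilinear avg_sum mulr_sumr.
under eq_bigr do rewrite avg_sum mulr_sumr.
set X := (X in _ = _ * X).
(* Each of the p^2 choices of a row pair and a column pair has the same average, given by
   [avg_four]. *)
have -> : pR ^+ 2 * X = \sum_(i < p) \sum_(j < p) X.
  by rewrite !sumr_const !card_ord -mulrnA -[RHS]mulr_natl natrM expr2.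
apply: eq_bigr => i _; apply: eq_bigr => j _.
rewrite /X -(@avg_four _ _ C B (pos (inl i, false)) (pos (inl i, true))
  (pos (inr j, false)) (pos (inr j, true)))//; last first.
  apply: (etrans (map_inj_uniq posI [:: (inl i, false); (inl i, true);
    (inr j, false); (inr j, true)])).
  by rewrite /= !inE !xpair_eqE !andbF.
congr (_ * _); apply: eq_avg => r.
rewrite /swap_kernel !big_bool /sgb/= expr0 expr1 /B !mxE /pos_mul.
by congr (_ * _); ring.
Qed.

Lemma mean_linearE (d w : 'I_n -> R) (s : 'S_n) :
  nR * (nR - 1) * mean_linear d w s =
  pR * (nR * \sum_i d i * w (s i) - (\sum_i d i) * (\sum_i w i)).
Proof.
rewrite /mean_linear /swap_linear avg_sum [LHS]mulr_sumr.
set Y := (X in _ = _ * X).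
have -> : pR * Y = \sum_(i < p) Y by rewrite sumr_const card_ord mulr_natl.
apply: eq_bigr => i _.
pose x := pos (inl i, false); pose y := pos (inl i, true).
rewrite (eq_avg (g := fun r : 'S_n => d (r x) * w (s (r x)) - d (r x) * w (s (r y)))).
  rewrite avgB mulrBr.
  have -> : nR * (nR - 1) * avg (fun r : 'S_n => d (r x) * w (s (r x))) =
      (nR - 1) * \sum_i d i * w (s i).
    by rewrite -(avg_perm1 x (fun i => d i * w (s i))); ring.
  have xy : uniq [:: x; y].
    apply: (etrans (map_inj_uniq posI [:: (inl i, false); (inl i, true)])).
    by rewrite /= !inE !xpair_eqE !andbF.
  rewrite (avg_perm2 (fun i j => d i * w (s j)) xy) /offdiag -big_distrlr/=.
  have ws : \sum_i w i = \sum_i w (s i) by apply: reindex_inj; exact: perm_inj.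
  by rewrite /Y ws; ring.
by move=> r; rewrite big_bool /sgb/= expr0 expr1 /pos_mul -/x -/y; ring.
Qed.

(** Chosen so that the sum of [C i i * linear_weight (s i)] restores the diagonal of the quadratic
    form and cancels the terms of [mean_bilinearE] that carry a diagonal entry of C. *)
Definition linear_weight (v : 'I_n) : R :=
  A v v - (nR - 1) / m * \sum_(u | u != v) (A v u + A u v).

Lemma linear_weight_le v : `|linear_weight v| <= 5.
Proof.
have nn := n20R; have mn := m_gt.
have S : `|\sum_(u | u != v) (A v u + A u v)| <= (nR - 1) * 2.
  apply: (le_trans (ler_norm_sum _ _ _)).
  apply: (@le_trans _ _ (\sum_(u | u != v) 2)).
    apply: ler_sum => u _; rewrite ler_norml.
    by have /andP[? ?] := A1 u v; have /andP[? ?] := A1 v u; apply/andP; split; lra.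
  rewrite sumr_const -[leLHS]mulr_natl ler_wpM2r//.
  have e : (1 + #|[pred u | u != v]|)%N = n.
    by have := cardC (pred1 v); rewrite card_ord card1.
  have : (1 + #|[pred u | u != v]|)%:R = nR by congr (_%:R).
  rewrite natrD => h; change (#|[pred u | u != v]|%:R <= nR - 1); lra.
have c0 : 0 <= (nR - 1) / m by rewrite divr_ge0; lra.
have c1 : (nR - 1) / m * ((nR - 1) * 2) <= 4.
  rewrite mulrAC ler_pdivrMr; last lra.
  rewrite /m; nra.
have /andP[? ?] := A1 v v.
have := ler_wpM2l c0 S; rewrite -{1}(ger0_norm c0) -normrM => h.
have := le_trans h c1; rewrite /linear_weight !ler_norml => /andP[? ?].
by apply/andP; split; lra.
Qed.

(** Solve [mean_bilinearE] for the quadratic form and express the resulting linear statistic through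
    [mean_linearE]. *)
Lemma QF_decomp : exists c : R, forall s : 'S_n,
  QF C A s = nR * (nR - 1) * (nR - 2) * (nR - 3) / (m * pR ^+ 2) * mean_bilinear s
  - m^-1 * offdiag (fun i j => C j i * A (s i) (s j))
  + (nR - 1) / pR * mean_linear (fun i => C i i) linear_weight s + c.
Proof.
have nn := n20R; have mn := m_gt; have pp := npR.
(* The first summand compensates the centering in [mean_linearE], the second the trace term of
   [mean_bilinearE], which is invariant under conjugation by [s]. *)
exists (nR^-1 * ((\sum_i C i i) * \sum_i linear_weight i) +
  m^-1 * ((\sum_i C i i) * offdiag (fun i j => A i j))) => s.
have m0 : m != 0 by apply/eqP; lra.
have p0 : pR != 0 by apply/eqP; lra.
have n0 : nR != 0 by apply/eqP; lra.
have e1 := mean_bilinearE s; have e2 := mean_linearE (fun i => C i i) linear_weight s.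
set N4 := nR * _ * _ * _ in e1 *.
have -> : N4 / (m * pR ^+ 2) * mean_bilinear s = (N4 * mean_bilinear s) / (m * pR ^+ 2).
  by rewrite mulrAC.
rewrite e1 {N4 e1}.
have -> : (nR - 1) / pR * mean_linear (fun i => C i i) linear_weight s =
    (nR * (nR - 1) * mean_linear (fun i => C i i) linear_weight s) / (nR * pR).
  by field; rewrite n0 p0.
rewrite e2 {e2}.
have -> : offdiag (fun i j => conj_perm A s i j) = offdiag (fun i j => A i j).
  rewrite /offdiag [in RHS](reindex_inj (@perm_inj _ s))/=.
  rewrite [X in _ = _ - X](reindex_inj (@perm_inj _ s))/=.
  congr (_ - _); apply: eq_bigr => i _; last by rewrite mxE.
  by rewrite [RHS](reindex_inj (@perm_inj _ s))/=; apply: eq_bigr => j _; rewrite mxE.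
have -> : offdiag (fun i j => C j i * conj_perm A s i j) =
    offdiag (fun i j => C j i * A (s i) (s j)).
  by rewrite /offdiag; congr (_ - _); apply: eq_bigr => i _; rewrite ?mxE//;
    apply: eq_bigr => j _; rewrite mxE.
have -> : offdiag (fun i j => C i j * conj_perm A s i j) =
    QF C A s - \sum_i C i i * A (s i) (s i).
  rewrite /offdiag /QF; congr (_ - _); apply: eq_bigr => i _; rewrite ?mxE//;
    by apply: eq_bigr => j _; rewrite mxE.
have -> : offdiag (fun i j => C i i * conj_perm A s i j) +
    offdiag (fun i j => C j j * conj_perm A s i j) =
    \sum_i C i i * \sum_(u | u != s i) (A (s i) u + A u (s i)).
  have h (G : 'I_n -> 'I_n -> R) i : \sum_j C i i * G i j - C i i * G i i =
      C i i * \sum_(j | j != i) G i j.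
    by rewrite -mulr_sumr -mulrBr (bigD1 i)//= addrAC subrr add0r.
  rewrite /offdiag [X in _ + (X - _)]exchange_big/= -!sumrB.
  rewrite (eq_bigr _ (fun i _ => h (fun i j => conj_perm A s i j) i)).
  rewrite [X in _ + X = _](eq_bigr _ (fun i _ => h (fun i j => conj_perm A s j i) i)).
  rewrite -big_split/=; apply: eq_bigr => i _; rewrite -mulrDr -big_split/=.
  congr (_ * _); rewrite [RHS](reindex_inj (@perm_inj _ s))/=.
  by apply: eq_big => [j|j _]; rewrite ?(inj_eq perm_inj)// !mxE.
have -> : \sum_i C i i * linear_weight (s i) = \sum_i C i i * A (s i) (s i) -
    (nR - 1) / m * \sum_i C i i * \sum_(u | u != s i) (A (s i) u + A u (s i)).
  rewrite mulr_sumr -sumrB; apply: eq_bigr => i _.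
  by rewrite /linear_weight; ring.
by field; rewrite n0 p0 m0.
Qed.

(** Center the three random parts of [QF_decomp] and split by convexity, at the price of tripling
    the exponents. The factors [a] and [b] stay bounded because n <= 8 p. *)
Lemma mgf_QF (lam : R) : 0 <= lam -> lam * L <= (10 ^+ 4)^-1 ->
  avg (fun s => expR (lam * (QF C A s - avg (QF C A)))) <= expR (3 * 10 ^+ 6 * lam ^+ 2 * F).
Proof.
move=> l0 lL.
have nn := n20R; have mn := m_gt; have pp := npR.
have [c hc] := QF_decomp.
set a := nR * _ * _ * _ / _ in hc; set b := (nR - 1) / pR in hc.
pose X2 (s : 'S_n) : R := - (m^-1 * offdiag (fun i j => C j i * A (s i) (s j))).
pose X1 := mean_bilinear; pose X3 := mean_linear (fun i => C i i) linear_weight.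
have X1E : avg X1 = 0.
  rewrite /X1 /mean_bilinear avg_exchange (eq_avg (g := fun=> 0)).
    by rewrite avg_cst// card_perm_gt0.
  by move=> r; exact: (avg_swap_bilinear (pos_mul_inj (r := r))).
have X3E : avg X3 = 0.
  rewrite /X3 /mean_linear avg_exchange (eq_avg (g := fun=> 0)).
    by rewrite avg_cst// card_perm_gt0.
  by move=> r; exact: (avg_swap_linear (pos_mul_inj (r := r))).
have QE : avg (QF C A) = avg X2 + c.
  rewrite (eq_avg (g := fun s => a * X1 s + X2 s + b * X3 s + c)); last exact: hc.
  by rewrite !avgD !avgZ X1E X3E avg_cst ?card_perm_gt0// !mulr0 add0r addr0.
have F0 : 0 <= F by exact: sqr_ge0.
have L0 : 0 <= L by exact: le_trans (opnorm_ge0 _) (CL 1%g).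
have a0 : 0 <= a.
  by rewrite /a divr_ge0 ?mulr_ge0//; try lra; rewrite ?sqr_ge0.
have a64 : a <= 64.
  rewrite /a ler_pdivrMr; last by rewrite mulr_gt0 ?exprn_gt0; lra.
  have h1 : nR * (nR - 1) * (nR - 2) * (nR - 3) <= nR ^+ 2 * m.
    have -> : nR * (nR - 1) * (nR - 2) * (nR - 3) =
      nR * ((nR - 3) * (m + 1)) by rewrite /m; ring.
    rewrite expr2 -mulrA ler_wpM2l; [nra|lra|].
    rewrite /m; nra.
  have h2 : nR ^+ 2 <= 64 * pR ^+ 2 by nra.
  have := ler_wpM2r (ltW (lt_trans (lt_le_trans ltr01 _) mn)) h2; lra.
have b0 : 0 <= b by rewrite /b divr_ge0; lra.
have b8 : b <= 8 by rewrite /b ler_pdivrMr; lra.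
have l2 := sqr_ge0 lam.
have l2F : 0 <= lam ^+ 2 * F by rewrite mulr_ge0.
apply: (@le_trans _ _ (3^-1 * avg (fun s => expR (3 * lam * a * X1 s)) +
   3^-1 * avg (fun s => expR (3 * lam * (X2 s - avg X2))) +
   3^-1 * avg (fun s => expR (3 * lam * b * X3 s)))).
  rewrite -!avgZ -!avgD; apply: avg_le => s.
  have -> : lam * (QF C A s - avg (QF C A)) =
    lam * a * X1 s + lam * (X2 s - avg X2) + lam * b * X3 s.
    by rewrite hc QE /X1 /X2 /X3; ring.
  by apply: (le_trans (expR_add3 _ _ _)); rewrite !mulrA; lra.
set E := expR (3 * _ * _ * _).
(* This part dictates the constants: with a <= 64, 64 * (3 * 64)^2 is below 3 * 10^6, and 2048 * (3
   * 64)^2 is below 10^8. *)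
have h1 : avg (fun s => expR (3 * lam * a * X1 s)) <= E.
  apply: avg_expR_avg => [|r]; first exact: card_perm_gt0.
  have a2 : a ^+ 2 <= 4096 by nra.
  have k : lam ^+ 2 * a ^+ 2 <= lam ^+ 2 * 4096 by rewrite ler_wpM2l.
  apply: le_trans (avg_expR_swap_bilinear (pos_mul_inj (r := r)) A1 CL _) _.
    have : (lam * L) ^+ 2 <= ((10 ^+ 4)^-1) ^+ 2.
      by rewrite ler_pXn2r// nnegrE ?mulr_ge0// invr_ge0 exprn_ge0.
    have := ler_wpM2r (sqr_ge0 L) k; lra.
  rewrite ler_expR; have := ler_wpM2r F0 k; rewrite -/F; lra.
(* By Cauchy-Schwarz the absolute entries of C sum to at most n times its Frobenius norm, and n < m;
   so [X2] is bounded by that norm. *)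
have h2 : avg (fun s => expR (3 * lam * (X2 s - avg X2))) <= E.
  apply: le_trans (avg_expR_bounded (B := frobenius_norm C) _ (card_perm_gt0 n) _) _.
    move=> s; rewrite /X2 normrN normrM ger0_norm ?invr_ge0; last lra.
    rewrite mulrC ler_pdivrMr; last lra.
    have -> : offdiag (fun i j => C j i * A (s i) (s j)) =
        \sum_i \sum_(j | j != i) C j i * A (s i) (s j).
      rewrite /offdiag -sumrB; apply: eq_bigr => i _.
      by rewrite (bigD1 i)//= addrAC subrr add0r.
    apply: (@le_trans _ _ (\sum_i \sum_j `|C j i|)).
      apply: (le_trans (ler_norm_sum _ _ _)); apply: ler_sum => i _.
      apply: (le_trans (ler_norm_sum _ _ _)).
      rewrite [leRHS](bigD1 i)//= -[leLHS]add0r lerD//; apply: ler_sum => j _.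
      by rewrite normrM -[leRHS]mulr1 ler_wpM2l// ler_norml.
    rewrite exchange_big/=.
    apply: (@le_trans _ _ (nR * frobenius_norm C)); last first.
      by rewrite mulrC ler_wpM2l ?frobenius_ge0// ltW.
    rewrite -(@ler_pXn2r _ 2)// ?nnegrE ?mulr_ge0 ?frobenius_ge0//; last first.
      by apply: sumr_ge0 => i _; apply: sumr_ge0.
    rewrite exprMn sqr_frobenius !pair_big/=.
    have := cauchy_schwarz_sum (fun=> 1) (fun u : 'I_n * 'I_n => `|C u.1 u.2|).
    rewrite /=; under eq_bigr do rewrite mul1r.
    move/le_trans; apply; rewrite sumr_const expr1n card_prod card_ord natrM -expr2.
    by under eq_bigr do rewrite real_normK ?num_real//.
  by rewrite ler_expR -/F; lra.
have h3 : avg (fun s => expR (3 * lam * b * X3 s)) <= E.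
  apply: avg_expR_avg => [|r]; first exact: card_perm_gt0.
  have b2 : b ^+ 2 <= 64 by nra.
  have k : lam ^+ 2 * b ^+ 2 <= lam ^+ 2 * 64 by rewrite ler_wpM2l.
  apply: le_trans (avg_expR_swap_linear (pos_mul_inj (r := r)) _ linear_weight_le _) _.
  rewrite ler_expR.
  have d2 : \sum_i C i i ^+ 2 <= F.
    rewrite /F sqr_frobenius; apply: ler_sum => i _.
    by rewrite [leRHS](bigD1 i)//= lerDl sumr_ge0// => j _; exact: sqr_ge0.
  have d0 : 0 <= \sum_i C i i ^+ 2 by apply: sumr_ge0 => i _; exact: sqr_ge0.
  have k1 := ler_wpM2r d0 k; have k2 := ler_wpM2l l2 d2; lra.
lra.
Qed.

End Mgf.

(** * Schur multipliers *)

Section Schur.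
Variables (R : realType) (n : nat).
Implicit Types b : 'I_n -> 'I_n -> R.

Lemma quad_shift b (x : 'I_n -> R) (t : R) (k : 'I_n) :
  (forall i j, b i j = b j i) ->
  \sum_i \sum_j (x i + t * (i == k)%:R) * b i j * (x j + t * (j == k)%:R) =
  \sum_i \sum_j x i * b i j * x j + 2 * t * (\sum_i x i * b i k) + t ^+ 2 * b k k.
Proof.
move=> bC.
have pick (G : 'I_n -> R) : \sum_i G i * (i == k)%:R = G k.
  rewrite (bigD1 k)//= eqxx mulr1 big1 ?addr0// => i /negbTE ->.
  by rewrite mulr0.
have inner i : \sum_j (x i + t * (i == k)%:R) * b i j * (x j + t * (j == k)%:R) =
    \sum_j x i * b i j * x j + t * (x i * b i k) +
    (t * \sum_j b i j * x j + t ^+ 2 * b i k) * (i == k)%:R.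
  rewrite -(pick (fun j => b i j)) mulrDl !mulr_sumr !mulr_suml -!big_split/=.
  by apply: eq_bigr => j _; ring.
rewrite (eq_bigr _ (fun i _ => inner i)) !big_split/= -mulr_sumr pick.
have -> : \sum_j b k j * x j = \sum_i x i * b i k.
  by apply: eq_bigr => j _; rewrite mulrC bC.
by ring.
Qed.

(* Gaussian elimination: each step subtracts a rank-one form and clears one more
   row. *)
Lemma psd_gram_seq (m : nat) b :
  (forall i j, b i j = b j i) ->
  (forall x : 'I_n -> R, 0 <= \sum_i \sum_j x i * b i j * x j) ->
  (forall i j : 'I_n, (m <= i)%N -> b i j = 0) ->
  exists s : seq ('I_n -> R), forall i j, b i j = \sum_(g <- s) g i * g j.
Proof.
elim: m b => [|m IH] b bC bP bm.
  by exists [::] => i j; rewrite big_nil bm.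
have [nm|mn] := leqP n m.
  by apply: IH => // i j mi; have := leq_trans (ltn_ord i) nm; rewrite ltnNge mi.
pose k := Ordinal mn.
have shift x t : 0 <= \sum_i \sum_j x i * b i j * x j
    + 2 * t * (\sum_i x i * b i k) + t ^+ 2 * b k k.
  by rewrite -quad_shift.
have bmk (i j : 'I_n) : (m <= i)%N -> i != k -> b i j = 0.
  move=> mi ik; apply: bm; rewrite ltn_neqAle mi andbT.
  by apply: contraNneq ik => e; apply/eqP/val_inj.
have [bk0|bk0] := eqVneq (b k k) 0.
  apply: IH => // i j mi; have [->|] := eqVneq i k; last exact: bmk.
  pose x (u : 'I_n) : R := (u == j)%:R.
  have := shift x; rewrite bk0.
  have -> : \sum_i x i * b i k = b j k.
    rewrite (bigD1 j)//= /x eqxx mul1r big1 ?addr0// => u /negbTE ->.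
    by rewrite mul0r.
  set q := \sum_i _ => h; apply/eqP; apply: contraT => c0.
  have bjk : b j k != 0 by rewrite bC.
  (* With a zero pivot the form is affine in the shift t, so a nonzero entry in row k would let it
     reach -1. *)
  have := h (- (q + 1) / (2 * b j k)); rewrite mulr0 addr0.
  have -> : q + 2 * (- (q + 1) / (2 * b j k)) * b j k = -1 by field.
  lra.
have bkp : 0 < b k k.
  rewrite lt_def bk0/=; have := shift (fun=> 0) 1.
  rewrite !big1 => [|i _|i _]; rewrite ?mul0r//; last by rewrite big1// => j _; rewrite !mul0r.
  by rewrite mulr0 !add0r expr1n mul1r.
have [|x|i j mi|s hs] := IH (fun i j => b i j - b i k * b j k / b k k).
- by move=> i j /=; rewrite bC (mulrC (b i k)).
(* This shift minimizes the form along the k-th direction; the minimum is the value of the Schur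
   complement at x. *)
- have := shift x (- (\sum_i x i * b i k) / b k k).
  set q := \sum_i \sum_j x i * b i j * x j; set c := \sum_i x i * b i k => h.
  have -> : \sum_i \sum_j x i * (b i j - b i k * b j k / b k k) * x j = q - c ^+ 2 / b k k.
    rewrite expr2 {1}/c big_distrlr/= mulr_suml -sumrB; apply: eq_bigr => i _.
    by rewrite mulr_suml -sumrB; apply: eq_bigr => j _; ring.
  apply: le_trans h _; rewrite le_eqVlt; apply/orP; left; apply/eqP.
  by field.
- have [->|ik] := eqVneq i k; last by rewrite !(bmk i)// !mul0r subrr.
  by rewrite (bC k j) mulrAC mulfV// mul1r subrr.
exists ((fun i => b i k / Num.sqrt (b k k)) :: s) => i j.
rewrite big_cons -hs.
have e : Num.sqrt (b k k) ^+ 2 = b k k by rewrite sqr_sqrtr// ltW.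
have s0 : Num.sqrt (b k k) != 0 by rewrite gt_eqF// sqrtr_gt0.
have -> : b i k / Num.sqrt (b k k) * (b j k / Num.sqrt (b k k)) =
    b i k * b j k / Num.sqrt (b k k) ^+ 2 by field.
by rewrite e addrC subrK.
Qed.

Lemma psd_gram (A : 'M[R]_n) : possemidef A ->
  exists (m : nat) (g : 'I_m -> 'I_n -> R), forall i j, A i j = \sum_k g k i * g k j.
Proof.
case=> AT AP.
have [|x|i j|s hs] := @psd_gram_seq n (fun i j => A i j).
- by move=> i j; rewrite -[in LHS]AT mxE.
- have := AP (\col_i x i); rewrite mxE; set q := \sum_i _; set q' := \sum_i _.
  have -> // : q = q'.
  rewrite /q /q' [LHS]exchange_big/=; apply: eq_bigr => j _.
  rewrite !mxE mulr_suml; apply: eq_bigr => i _.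
  by rewrite !mxE.
- by rewrite leqNgt ltn_ord.
exists (size s), (fun k => nth (fun=> 0) s k) => i j.
by rewrite hs (big_nth (fun=> 0)) big_mkord.
Qed.

(* With A i j = <g_i, g_j>, the Schur multiplier C |-> C o A is
   v |-> sum_k diag(g^k) C diag(g^k) v; Cauchy-Schwarz in k and
   |g_i|^2 = A i i <= 1 give the bound. *)
Lemma opnorm_hadamard_psd (C A : 'M[R]_n) (s : 'S_n) :
  possemidef A -> (forall i, A i i <= 1) ->
  opnorm (hadamard C (conj_perm A s)) <= opnorm C.
Proof.
move=> /psd_gram[m [g hg]] A1; apply: opnorm_le; first exact: opnorm_ge0.
move=> v.
apply: (@le_trans _ _ (\sum_i \sum_k (\sum_j C i j * (g k (s j) * v j)) ^+ 2)).
  apply: ler_sum => i _.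
  have -> : \sum_j hadamard C (conj_perm A s) i j * v j =
      \sum_k g k (s i) * \sum_j C i j * (g k (s j) * v j).
    under [RHS]eq_bigr do rewrite mulr_sumr.
    rewrite exchange_big/=; apply: eq_bigr => j _.
    rewrite !mxE hg mulr_sumr mulr_suml; apply: eq_bigr => k _; ring.
  apply: (le_trans (cauchy_schwarz_sum _ _)).
  rewrite -[leRHS]mul1r ler_wpM2r ?sumr_ge0//; first by move=> k _; exact: sqr_ge0.
  by apply: le_trans (A1 (s i)); rewrite hg.
rewrite exchange_big/=.
apply: (@le_trans _ _ (\sum_k opnorm C ^+ 2 * \sum_j (g k (s j) * v j) ^+ 2)).
  by apply: ler_sum => k _; exact: sqr_opnorm_le.
rewrite -mulr_sumr ler_wpM2l ?sqr_ge0// exchange_big/=; apply: ler_sum => j _.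
have -> : \sum_k (g k (s j) * v j) ^+ 2 = A (s j) (s j) * v j ^+ 2.
  by rewrite hg mulr_suml; apply: eq_bigr => k _; rewrite exprMn expr2.
by rewrite -[leRHS]mul1r ler_wpM2r ?sqr_ge0.
Qed.

End Schur.

(** * Tail bounds *)

Section UniformPerm.
Variables (R : realType) (d : measure_display) (T : measurableType d).
Variables (P : probability T R) (n : nat) (pi : T -> 'S_n).
Hypothesis piU : uniform_perm P pi.

(** The integrand is a finite combination of indicators of the fibres of [pi], whose measurability
    and mass are known. *)
Lemma expectation_uniform_perm (g : 'S_n -> R) :
  ('E_P[fun w => g (pi w)] = (avg g)%:E)%E.
Proof.
rewrite unlock.
pose f s w : \bar R := ((g s)%:E * (\1_(pi @^-1` [set s]) w : R)%:E)%E.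
have mf s : P.-integrable setT (f s).
  by apply: integrableZl => //; apply: integrable_indic; have [] := piU s.
have -> : (\int[P]_w (g (pi w))%:E = \int[P]_w \sum_s f s w)%E.
  apply: eq_integral => w _.
  rewrite (bigD1 (pi w))//= big1 /f ?indicE.
    by rewrite mem_set// mule1 adde0.
  move=> s /eqP sw; rewrite indicE memNset ?mule0//= => e; exact: sw.
rewrite integral_sum// /avg card_Sn mulr_suml -sumEFin; apply: eq_bigr => s _.
have [ms Ps] := piU s.
rewrite /f integralZl//; last exact: integrable_indic.
by rewrite integral_indic// setIT EFinM; congr (_ * _)%E; exact: Ps.
Qed.

Lemma probability_uniform_perm (b : pred 'S_n) :
  P [set w | b (pi w)] = (avg (fun s => (b s)%:R))%:E.
Proof.
rewrite -expectation_uniform_perm -expectation_indic.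
  congr expectation; apply/funext => w; rewrite indicE.
  by case: (boolP (b (pi w))) => bw; [rewrite mem_set|rewrite memNset//; exact/negP].
have -> : [set w | b (pi w)] = \bigcup_(s in [set s | b s]) (pi @^-1` [set s]).
  by apply/seteqP; split => w /=; [exists (pi w)|case=> s /= bs ->].
by apply: fin_bigcup_measurable => [|s _]; [exact: finite_finset|have [] := piU s].
Qed.

End UniformPerm.

Section Tail.
Variables (R : realType) (N : nat) (C A : 'M[R]_N).
Hypothesis N20 : (20 <= N)%N.
Hypothesis hC : doubly_centered C.
Hypothesis A1 : forall i j, -1 <= A i j <= 1.

Let F := frobenius_norm C ^+ 2.

Lemma exists_disjoint_pairs : exists (p : nat) (pos : ('I_p + 'I_p) * bool -> 'I_N),
  (N <= 8 * p)%N /\ injective pos.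
Proof.
(* The 2 p pairs occupy 4 p <= N positions, while N < 4 (p + 1) <= 8 p. *)
pose p := (N %/ 4)%N.
have e : (4 * p <= N)%N by rewrite mulnC leq_divM.
have N8 : (N <= 8 * p)%N.
  have := ltn_ceil N (isT : (0 < 4)%N); rewrite -/p => h1.
  have h2 : (2 <= p)%N by rewrite leq_divRL// (leq_trans _ N20).
  apply: (leq_trans (ltnW h1)); rewrite mulnC -[8%N]/(4 * 2)%N -mulnA leq_pmul2l//.
  by rewrite mul2n -addnn -addn1 leq_add2l (leq_trans _ h2).
have c : (#|{: ('I_p + 'I_p) * bool}| <= N)%N.
  by rewrite card_prod card_sum card_bool card_ord addnn -mul2n mulnC mulnA.
exists p, (fun u => widen_ord c (enum_rank u)); split => // u v /(congr1 val)/= e'.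
by apply: enum_rank_inj; apply: val_inj.
Qed.

Lemma tail_QF (L t : R) : 0 < t ->
  (forall s : 'S_N, opnorm (hadamard C (conj_perm A s)) <= L) -> 0 < F + L * t ->
  avg (fun s => (t <= QF C A s - avg (QF C A))%R%:R) <=
  expR (- ((10 ^+ 8)^-1 * t ^+ 2 / (F + L * t))).
Proof.
move=> t0 CL D0.
have L0 : 0 <= L by exact: le_trans (opnorm_ge0 _) (CL 1%g).
have F0 : 0 <= F by exact: sqr_ge0.
have [p [pos [Np posI]]] := exists_disjoint_pairs.
(* Chernoff with lam = t / D: the second summand keeps lam L within the range of [mgf_QF], and the
   first makes the exponent given there at most lam t / 2. *)
pose D := 6 * 10 ^+ 6 * F + 10 ^+ 4 * (L * t).
have Lt0 : 0 <= L * t by rewrite mulr_ge0// ltW.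
have Dp : 0 < D by rewrite /D; lra.
pose lam := t / D.
have l0 : 0 <= lam by rewrite divr_ge0// ltW.
have lL : lam * L <= (10 ^+ 4)^-1.
  rewrite /lam mulrAC ler_pdivrMr// /D; lra.
have := mgf_QF posI N20 Np hC A1 CL l0 lL; rewrite -/F => mgf.
apply: (@le_trans _ _ (expR (- (lam * t)) *
    avg (fun s => expR (lam * (QF C A s - avg (QF C A)))))).
  rewrite -avgZ; apply: avg_le => s; rewrite -expRD.
  case: (boolP (t <= _)) => [h|_]; last by rewrite mulr0n expR_ge0.
  rewrite mulr1n -expR0 ler_expR; have := ler_wpM2l l0 h; lra.
apply: (le_trans (ler_wpM2l (expR_ge0 _) mgf)); rewrite -expRD ler_expR.
have lD : lam * D = t by rewrite /lam divfK// gt_eqF.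
have h1 : 3 * 10 ^+ 6 * lam ^+ 2 * F <= lam * t / 2.
  have k : 6 * 10 ^+ 6 * F <= D by rewrite /D; lra.
  have := ler_wpM2l (mulr_ge0 l0 l0) k.
  have -> : lam * lam * D = lam * t by rewrite -mulrA lD.
  lra.
(* D is at most 10^7 (F + L t), so halving still leaves room for the constant 10^-8. *)
have h2 : (10 ^+ 8)^-1 * t ^+ 2 / (F + L * t) <= lam * t / 2.
  rewrite ler_pdivrMr//.
  have k : D <= 10 ^+ 7 * (F + L * t) by rewrite /D; lra.
  have := ler_wpM2l (mulr_ge0 l0 (ltW t0)) k.
  have -> : lam * t * D = t ^+ 2 by rewrite mulrAC lD expr2.
  have := mulr_ge0 (mulr_ge0 l0 (ltW t0)) (ltW D0); lra.
lra.
Qed.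

Lemma opnorm_hadamard_le_max (s : 'S_N) :
  opnorm (hadamard C (conj_perm A s)) <= max_opnorm_hadamard C A.
Proof. exact: (@le_bigmax _ _ _ _ (fun s => opnorm (hadamard C (conj_perm A s))) s). Qed.

End Tail.

(** * Degenerate denominators and the final bounds *)

Lemma expeR_ratio (R : realType) (a D : R) : 0 < a -> 0 <= D ->
  expeR (- (a%:E / D%:E))%E = if D == 0 then 0%E else (expR (- (a / D)))%:E.
Proof.
move=> a0 D0; rewrite inver; case: eqVneq => [_|_]; last by rewrite -EFinM -EFinN.
by rewrite gt0_muley// lte_fin.
Qed.

Lemma frobenius_eq0 (R : realType) (m n : nat) (C : 'M[R]_(m, n)) :
  frobenius_norm C ^+ 2 = 0 -> C = 0.
Proof.
rewrite sqr_frobenius => h; apply/matrixP => i j; rewrite mxE.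
have h1 : \sum_j C i j ^+ 2 = 0.
  apply: (psumr_eq0P _ h) => // k _; apply: sumr_ge0 => l _; exact: sqr_ge0.
have h2 : C i j ^+ 2 = 0.
  by apply: (psumr_eq0P _ h1) => // k _; exact: sqr_ge0.
by apply/eqP; rewrite -sqrf_eq0 h2.
Qed.

(* The exponents are extended reals, where x / 0 = +oo for x > 0 and
   expeR -oo = 0: this is the reading of the bounds when C = 0. *)
Theorem theorem1p1 (R : realType) :
  exists K : R, 0 < K /\
  forall (N : nat) (C A : 'M[R]_N)
    (d : measure_display) (T : measurableType d) (P : probability T R)
    (pi : T -> 'S_N),
  (20 <= N)%N ->
  doubly_centered C ->
  (forall i j : 'I_N, -1 <= A i j <= 1) ->
  uniform_perm P pi ->
  let Q : T -> R := fun w => QF C A (pi w) in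
  forall t : R, 0 < t ->
  (P [set w | t%:E <= (Q w)%:E - 'E_P[Q]] <=
     expeR (- ((K * t ^+ 2)%:E /
       (frobenius_norm C ^+ 2 +
        (opnorm C + max_opnorm_hadamard C A) * t)%:E)))%E
  /\
  (possemidef A ->
   (P [set w | t%:E <= (Q w)%:E - 'E_P[Q]] <=
      expeR (- ((K * t ^+ 2)%:E /
        (frobenius_norm C ^+ 2 + opnorm C * t)%:E)))%E).
Proof.
exists (10 ^+ 8)^-1; split => // N C A d T P pi N20 hC A1 piU Q t t0.
pose b s := t <= QF C A s - avg (QF C A).
have -> : [set w | (t%:E <= (Q w)%:E - 'E_P[Q])%E] = [set w | b (pi w)].
  by apply/funext => w /=; rewrite (expectation_uniform_perm piU) -EFinB lee_fin.
rewrite (probability_uniform_perm piU).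
have F0 : 0 <= frobenius_norm C ^+ 2 by exact: sqr_ge0.
(* Both parts are instances of this bound, with L the sum of the two norms in (i) and L = [opnorm C]
   in (ii). *)
have main (L : R) : (forall s : 'S_N, opnorm (hadamard C (conj_perm A s)) <= L) ->
    ((avg (fun s => (b s)%:R : R))%:E <= expeR (- (((10 ^+ 8)^-1 * t ^+ 2)%:E /
      (frobenius_norm C ^+ 2 + L * t)%:E)))%E.
  move=> CL; have L0 : 0 <= L by exact: le_trans (opnorm_ge0 _) (CL 1%g).
  have Lt0 : 0 <= L * t by rewrite mulr_ge0// ltW.
  rewrite expeR_ratio ?addr_ge0//; last by rewrite mulr_gt0 ?invr_gt0 ?exprn_gt0.
  case: eqVneq => [|D0]; last first.
    by rewrite lee_fin; apply: tail_QF => //; rewrite lt_def D0 addr_ge0.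
  (* A zero denominator forces C = 0; then the quadratic form vanishes identically and, as t > 0,
     the event is empty. *)
  move/eqP; rewrite paddr_eq0// => /andP[/eqP/frobenius_eq0 C0 _].
  have Q0 s : QF C A s = 0.
    by rewrite /QF C0 big1// => i _; rewrite big1// => j _; rewrite mxE mul0r.
  rewrite lee_fin (eq_avg (g := fun=> 0)) ?avg_cst ?card_perm_gt0// => s.
  rewrite /b Q0 (eq_avg Q0) avg_cst ?card_perm_gt0// subrr.
  by case: leP => // /(lt_le_trans t0); rewrite ltxx.
split=> [|Apsd]; apply: main => s.
  by rewrite (le_trans (opnorm_hadamard_le_max C A s))// lerDr opnorm_ge0.
by apply: opnorm_hadamard_psd => // i; have /andP[] := A1 i i.
Qed.
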